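(* There is an absolute constant $C>0$ and a function $f:\mathbb{N}\to\mathbb{R}$ with $f(n)\to 0$ as $n\to\infty$ such that, for all integers $d,k\ge 1$, if $G$ is the $(d,k)$-grid and $n=(k+1)^d$, then for any vertex $s\in V(G)$, $$\Pr\{\tau(G,s)\le C k\}\ge 1-f(n).$$
   Context: The $(d,k)$-grid is the graph with vertex set $\{0,\dots,k\}^d$ in which two vertices are adjacent if and only if their Euclidean distance is $1$. First-passage percolation: given a connected graph $G$, assign independent exponential random variables $\tau(e)$ of mean $1$ to the edges $e$ of $G$. For a path $\gamma$ put $\tau(\gamma)=\sum_{e\in\gamma}\tau(e)$. For $s,v\in V(G)$ let $\Gamma(s,v)$ be the set of all $(s,v)$-paths in $G$, let $\tau(G,s,v)=\min_{\gamma\in\Gamma(s,v)}\tau(\gamma)$, and let the first-passage percolation cover time be $\tau(G,s)=\max_{v\in V(G)}\tau(G,s,v)$. *)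

(* Defs.v *)
From HB Require Import structures.
From mathcomp Require Import all_boot all_order all_algebra.
From mathcomp Require Import all_classical all_reals all_analysis.

Set Implicit Arguments.
Unset Strict Implicit.
Unset Printing Implicit Defensive.

Import Order.TTheory GRing.Theory Num.Theory.
Import numFieldNormedType.Exports.

Local Open Scope classical_set_scope.
Local Open Scope ring_scope.

(* A finite simple graph is given by its adjacency relation on a finType; the
   edge joining x and y is the unordered pair [set x; y]. *)

Definition edges (V : finType) (adj : rel V) : {set {set V}} :=
  [set a | [exists x, exists y, adj x y && (a == [set x; y])]]%SET.

(* The path s, p_1, ..., p_m is represented by its start s and its tail p. *)
Definition is_st_path (V : finType) (adj : rel V) (s v : V) (p : seq V) : bool :=
  [&& path adj s p, uniq (s :: p) & last s p == v].

Definition path_edges (V : finType) (s : V) (p : seq V) : seq {set V} :=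
  pairmap (fun x y => [set x; y]%SET) s p.

Definition path_time (R : realType) (V : finType) (w : {set V} -> R)
    (s : V) (p : seq V) : R :=
  \sum_(a <- path_edges s p) w a.

(* Since the vertices of a path are distinct, its tail has at most #|V|
   entries, so the finite type {bseq #|V| of V} contains every path.  Times
   are extended reals so that the minimum over an empty set of paths is +oo. *)
Definition fpp_time (R : realType) (V : finType) (adj : rel V)
    (w : {set V} -> R) (s v : V) : \bar R :=
  \big[Order.min/+oo%E]_(p : {bseq #|V| of V} | is_st_path adj s v p)
    (path_time w s p)%:E.

Definition fpp_cover_time (R : realType) (V : finType) (adj : rel V)
    (w : {set V} -> R) (s : V) : \bar R :=
  \big[Order.max/-oo%E]_(v : V) fpp_time adj w s v.

Definition mutually_independent (R : realType) (dT : measure_display)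
    (T : measurableType dT) (P : probability T R) (I : finType) (D : {set I})
    (X : I -> {RV P >-> R}) : Prop :=
  forall (J : {set I}) (B : I -> set R),
    J \subset D -> (forall i, measurable (B i)) ->
    P (\bigcap_(i in [set` J]) (X i @^-1` B i)) =
      (\prod_(i in J) P (X i @^-1` B i))%E.

(* The argument of exponential_prob is the rate, i.e. the inverse of the mean.
   The values of tau outside edges adj are unconstrained and play no role. *)
Definition fpp_weights (R : realType) (dT : measure_display)
    (T : measurableType dT) (P : probability T R) (V : finType) (adj : rel V)
    (tau : {set V} -> {RV P >-> R}) : Prop :=
  (forall a, a \in edges adj -> forall B : set R, measurable B ->
     distribution P (tau a) B = exponential_prob (1 : R) B) /\
  mutually_independent (edges adj) tau.

Definition grid_vertex (d k : nat) : finType := {ffun 'I_d -> 'I_k.+1}.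

Definition euclidean_dist (R : realType) (d k : nat)
    (x y : grid_vertex d k) : R :=
  Num.sqrt (\sum_(i < d) ((x i)%:R - (y i)%:R) ^+ 2).

Definition grid_adj (R : realType) (d k : nat) : rel (grid_vertex d k) :=
  fun x y => euclidean_dist R x y == 1.

(* Main.v *)
Require Import Defs.
From HB Require Import structures.
From mathcomp Require Import all_boot all_order all_algebra.
From mathcomp Require Import all_classical all_reals all_analysis.
From mathcomp Require Import measurable_realfun.
From mathcomp Require Import ring lra zify.

(** First-passage percolation covers the grid in time linear in its side.

    Crossing a cube.  The monotone paths between two opposite corners of the
    cube {0,1}^D are the D! orders in which the coordinates can be flipped.
    Call an edge open when its weight is at most 96 / D.  The number of open
    monotone paths has a second moment at most 4 times the square of its mean:
    a pair of paths is penalised according to the edges that it shares, and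
    cutting the second path at these edges gives a recursion which bounds the
    total penalty by a constant times D! ([overlap_full],
    [overlap_bound_rec]).  Hence some monotone path is open with probability at
    least 1/4 ([second_moment], [blocked_bernoulli]).  If the edges are closed
    with probability q ^ m instead of q, the set of open edges is distributed as
    the union of m independent percolations, so the failure probability is at
    most its m-th power ([percolation_prob_mul]).  Multiplying the time by m has
    exactly this effect on exponential weights: the crossing time exceeds 96 m
    with probability at most (3/4) ^ m ([blocked_pow]), and its mean is at most
    384, whatever D is ([expect_crossing_time]).

    Crossing the grid.  Moving every coordinate by one unit towards its target,
    one joins any two vertices by at most k cube crossings.  The mean passage
    time along this route is at most 384 k, so that by the Markov inequality it
    exceeds c k with a probability that is small when c is large
    ([travel_markov]).

    Amplification.  The union bound over the (k + 1) ^ d targets requires a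
    failure probability exponentially small in k d.  Let x and y agree on a set
    H of coordinates.  For i in H and each value j other than x_i, one can go
    from x along direction i to the hyperplane of value j, travel there to the
    copy of y while keeping the coordinates of H fixed, and come back along
    direction i.  The k |H| travels use disjoint sets of edges, hence fail
    independently, and the straight lines are slow with probability
    exponentially small in k by an exponential moment bound.  This gives a
    failure probability at most (3 (384 / c) ^ k) ^ |H|
    ([prob_no_reach_agreeing]).  Arbitrary x and y are joined through a vertex
    that takes half of its coordinates from each of them ([prob_no_reach]).

    Discretisation.  The argument takes place in a finite product space.  The
    weights are rounded down to multiples of 1 / n, where n is the number of
    vertices, and truncated at a high level.  A simple path has at most n edges,
    so rounding costs at most 1, which is at most k; and the probability that
    some weight is truncated is at most 1 / n.  The event about the original
    weights is then bounded through the joint law of the rounded weights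
    ([prob_levels], [fpp_time_le]). *)

Set Implicit Arguments.
Unset Strict Implicit.
Unset Printing Implicit Defensive.

Import Order.TTheory GRing.Theory Num.Theory.
Import numFieldNormedType.Exports.

Local Open Scope ring_scope.

(** * Finite product measures *)

Section ProductExpectation.
Variables (R : realType) (I S : finType) (mu : I -> S -> R).

Definition expect (F : {ffun I -> S} -> R) : R :=
  \sum_(s : {ffun I -> S}) (\prod_i mu i (s i)) * F s.

Definition prob (A : pred {ffun I -> S}) : R := expect (fun s => (A s)%:R).

(** [A] is the set of coordinates on which [F] may depend; it is a predicate so
    that sets of edges can be described by their geometry. *)
Definition depends_on (X : Type) (A : pred I) (F : {ffun I -> S} -> X) :=
  forall s t : {ffun I -> S}, (forall i, A i -> s i = t i) -> F s = F t.

Lemma expect_prod (f : I -> S -> R) :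
  expect (fun s => \prod_i f i (s i)) = \prod_i \sum_x mu i x * f i x.
Proof.
rewrite bigA_distr_bigA /expect; apply: eq_bigr => s _.
by rewrite big_split.
Qed.

Lemma eq_expect F G : F =1 G -> expect F = expect G.
Proof. by move=> FG; apply: eq_bigr => s _; rewrite FG. Qed.

Lemma expectD F G : expect (fun s => F s + G s) = expect F + expect G.
Proof. by rewrite -big_split; apply: eq_bigr => s _; rewrite mulrDr. Qed.

Lemma expectZ c F : expect (fun s => c * F s) = c * expect F.
Proof. by rewrite big_distrr; apply: eq_bigr => s _ /=; rewrite mulrCA. Qed.

Lemma expect_sum (T : Type) (l : seq T) (P : pred T) (F : T -> _ -> R) :
  expect (fun s => \sum_(t <- l | P t) F t s) = \sum_(t <- l | P t) expect (F t).
Proof.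
rewrite exchange_big; apply: eq_bigr => s _ /=.
by rewrite big_distrr.
Qed.

Hypothesis mu_ge0 : forall i x, 0 <= mu i x.

Lemma ler_expect F G : (forall s, F s <= G s) -> expect F <= expect G.
Proof.
move=> FG; apply: ler_sum => s _.
by apply: ler_wpM2l => //; apply: prodr_ge0.
Qed.

Lemma expect_ge0 F : (forall s, 0 <= F s) -> 0 <= expect F.
Proof.
by move=> F0; apply: sumr_ge0 => s _; rewrite mulr_ge0 //; apply: prodr_ge0.
Qed.

Lemma ler_prob (A B : pred {ffun I -> S}) : (forall s, A s -> B s) -> prob A <= prob B.
Proof.
move=> AB; apply: ler_expect => s.
by case EA: (A s) => //; rewrite AB.
Qed.

Lemma prob_ge0 A : 0 <= prob A.
Proof. by apply: expect_ge0. Qed.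

Lemma probU A B : prob (fun s => A s || B s) <= prob A + prob B.
Proof.
rewrite /prob -expectD; apply: ler_expect => s.
by case: (A s); case: (B s); rewrite /= ?addr0 ?add0r // lerDl.
Qed.

Lemma prob_exists (F : finType) (A : F -> pred {ffun I -> S}) :
  prob (fun s => [exists t, A t s]) <= \sum_t prob (A t).
Proof.
rewrite -expect_sum; apply: ler_expect => s.
case: existsP => [[t At]|_]; last by apply: sumr_ge0.
by rewrite (bigD1 t) //= At lerDl sumr_ge0.
Qed.

Lemma markov_expect F r : 0 < r -> (forall s, 0 <= F s) ->
  prob (fun s => r < F s) <= expect F / r.
Proof.
move=> r0 F0; rewrite mulrC -expectZ; apply: ler_expect => s.
case: ltP => [rF|_]; last by rewrite mulr_ge0 // invr_ge0 ltW.
by rewrite mulrC ler_pdivlMr // mul1r ltW.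
Qed.

Hypothesis mu_sum : forall i, \sum_x mu i x = 1.

Lemma weight_sum1 : \sum_(s : {ffun I -> S}) \prod_i mu i (s i) = 1.
Proof. by rewrite -bigA_distr_bigA big1. Qed.

Lemma expect_cst c : expect (fun=> c) = c.
Proof. by rewrite /expect -big_distrl /= weight_sum1 mul1r. Qed.

Lemma expect_coord i (f : S -> R) :
  expect (fun s => f (s i)) = \sum_x mu i x * f x.
Proof.
rewrite (eq_expect (G := fun s =>
  \prod_j (if j == i then f (s j) else 1))); last first.
  by move=> s; rewrite -big_mkcond big_pred1_eq.
rewrite (expect_prod (fun j x => if j == i then f x else 1)) (bigD1 i) //= eqxx.
rewrite [X in _ * X]big1 ?mulr1 // => j /negbTE ->.
by under eq_bigr do rewrite mulr1; rewrite mu_sum.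
Qed.

(** Exchange the coordinates in [A] between two independent samples: this
    preserves the product of the two weights, and it turns the pair
    [F s], [G t] into the pair [F s], [G s]. *)
Lemma expect_indep (A B : pred I) F G :
  depends_on A F -> depends_on B G -> (forall i, A i -> ~~ B i) ->
  expect (fun s => F s * G s) = expect F * expect G.
Proof.
move=> dF dG AB.
pose mix (s t : {ffun I -> S}) := [ffun i => if A i then s i else t i].
rewrite [RHS]big_distrl /=.
under [RHS]eq_bigr do rewrite big_distrr /=.
rewrite pair_big /=.
pose h (u : {ffun I -> S} * {ffun I -> S}) := (mix u.1 u.2, mix u.2 u.1).
have hK : involutive h.
  by move=> [s t]; congr pair; apply/ffunP => i; rewrite !ffunE; case: (A i).
rewrite (reindex_inj (inv_inj hK)) /=.
transitivity (\sum_(u : {ffun I -> S} * {ffun I -> S})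
   (\prod_i mu i (u.1 i) * (F u.1 * G u.1)) * \prod_i mu i (u.2 i)).
  rewrite -(pair_big xpredT xpredT (fun s t : {ffun I -> S} =>
    (\prod_i mu i (s i) * (F s * G s)) * \prod_i mu i (t i))) /=.
  apply: eq_bigr => s _; rewrite -big_distrr /=.
  by rewrite weight_sum1 mulr1.
apply: eq_bigr => -[s t] _ /=.
have -> : F (mix s t) = F s.
  by apply: dF => i Ai; rewrite ffunE Ai.
have -> : G (mix t s) = G s.
  apply: dG => i Bi; rewrite ffunE; case: ifPn => // /AB.
  by rewrite Bi.
have E : \prod_i mu i (mix s t i) * \prod_i mu i (mix t s i)
       = \prod_i mu i (s i) * \prod_i mu i (t i).
  rewrite -!big_split; apply: eq_bigr => i _ /=; rewrite !ffunE.
  by case: (A i) => //; rewrite mulrC.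
by rewrite [RHS]mulrACA E mulrAC.
Qed.

Lemma expect_indep_seq (T : eqType) (l : seq T) (A : T -> pred I)
    (F : T -> {ffun I -> S} -> R) :
  uniq l -> (forall t, t \in l -> depends_on (A t) (F t)) ->
  (forall t u i, t \in l -> u \in l -> A t i -> A u i -> t = u) ->
  expect (fun s => \prod_(t <- l) F t s) = \prod_(t <- l) expect (F t).
Proof.
elim: l => [|t l IH] /=.
  by rewrite big_nil => _ _ _; under eq_expect do rewrite big_nil; apply: expect_cst.
move=> /andP[tl ul] dF dis; rewrite big_cons.
under eq_expect do rewrite big_cons.
rewrite (@expect_indep (A t) (fun i => has (fun u => A u i) l)).
- rewrite IH // => [u ul'|u v i ul' vl]; first by apply: dF; rewrite inE ul' orbT.
  by apply: dis; rewrite inE ?ul' ?vl orbT.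
- by apply: dF; rewrite mem_head.
- move=> s s' ss'; apply: eq_big_seq => u ul'; apply: dF => [|i Ai].
    by rewrite inE ul' orbT.
  by apply: ss'; apply/hasP; exists u.
move=> i Ai; apply/hasPn => u ul'; apply/negP => Au.
have tu : t = u by apply: (dis _ _ i) => //; rewrite inE ?eqxx ?ul' ?orbT.
by rewrite tu ul' in tl.
Qed.

Lemma prob_indep_seq (T : eqType) (l : seq T) (A : T -> pred I)
    (F : T -> pred {ffun I -> S}) :
  uniq l -> (forall t, t \in l -> depends_on (A t) (F t)) ->
  (forall t u i, t \in l -> u \in l -> A t i -> A u i -> t = u) ->
  prob (fun s => all (fun t => F t s) l) = \prod_(t <- l) prob (F t).
Proof.
move=> ul dF dis; rewrite -(expect_indep_seq ul _ dis) => [|t tl s s' /(dF _ tl) ->//].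
apply: eq_expect => s; elim: (l) => [|t l' IH]; first by rewrite big_nil.
by rewrite big_cons -IH /=; case: (F t s); rewrite ?mul1r ?mul0r.
Qed.

End ProductExpectation.

(** * Percolation and monotone events *)

Section Percolation.
Variables (R : realType) (I : finType).
Implicit Types (q : I -> R) (A : pred {set I}) (l : seq I) (O : {set I}).

(** Probability of [A] for the random set obtained from [O] by adding each
    element [i] of [l] independently with probability [1 - q i].  Revealing the
    elements one at a time makes the monotonicity properties below inductive. *)
Fixpoint percolation_prob q A l O : R :=
  if l is i :: l' then
    q i * percolation_prob q A l' O +
    (1 - q i) * percolation_prob q A l' (i |: O)
  else (A O)%:R.

Definition antimonotone A := forall O O', O \subset O' -> A O' -> A O.

Lemma prob_percolation (S : finType) (mu : I -> S -> R) (op : I -> pred S) A l O :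
  (forall i x, 0 <= mu i x) -> (forall i, \sum_x mu i x = 1) -> uniq l ->
  prob mu (fun s => A (O :|: [set i in l | op i (s i)])) =
    percolation_prob (fun i => \sum_(x | ~~ op i x) mu i x) A l O.
Proof.
move=> mu0 mu1; elim: l O => [|i l IH] O /=.
  move=> _; rewrite -[RHS](@expect_cst _ _ _ mu) //; apply: eq_expect => s.
  by congr (A _)%:R; apply/setP => j; rewrite !inE orbF.
move=> /andP[il ul].
have dep X : depends_on (mem l)
    (fun s : {ffun I -> S} => (A (X :|: [set j in l | op j (s j)])) %:R : R).
  move=> s t st; congr (A _)%:R; apply/setP => j; rewrite !inE.
  by case jl: (j \in l) => //=; rewrite st.
have ind (f : S -> R) X :
    expect mu (fun s => f (s i) * (A (X :|: [set j in l | op j (s j)]))%:R) =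
    (\sum_x mu i x * f x) * prob mu (fun s => A (X :|: [set j in l | op j (s j)])).
  rewrite (expect_indep mu1 (A := pred1 i) (B := mem l)) //.
  - by rewrite expect_coord.
  - by move=> s t st; rewrite st /=.
  - by move=> j /eqP->.
rewrite -!IH //.
have -> : \sum_(x | ~~ op i x) mu i x = \sum_x mu i x * (~~ op i x)%:R.
  by rewrite big_mkcond; apply: eq_bigr => x _; case: (op i x); rewrite ?mulr1 ?mulr0.
have -> : 1 - \sum_x mu i x * (~~ op i x)%:R = \sum_x mu i x * (op i x)%:R.
  apply/eqP; rewrite subr_eq -big_split /=; apply/eqP; rewrite -[LHS](mu1 i).
  by apply: eq_bigr => x _; case: (op i x); rewrite !(mulr1, mulr0, addr0, add0r).
rewrite -(ind (fun x => (~~ op i x)%:R) O) -(ind (fun x => (op i x)%:R)) -expectD.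
apply: eq_expect => s; case E: (op i (s i)); rewrite ?mul1r ?mul0r ?addr0 ?add0r;
  congr (A _)%:R; apply/setP => j; rewrite !inE; case: eqP => [->|] //=;
  by rewrite E ?(negbTE il) ?orbT //= ?andbF.
Qed.

Lemma percolation_prob_ge0 q A l O : (forall i, 0 <= q i <= 1) -> 0 <= percolation_prob q A l O.
Proof.
move=> q01; elim: l O => [|i l IH] O //=.
have /andP[q0 q1] := q01 i.
by rewrite addr_ge0 // mulr_ge0 // subr_ge0.
Qed.

Lemma percolation_prob_le1 q A l O : (forall i, 0 <= q i <= 1) -> percolation_prob q A l O <= 1.
Proof.
move=> q01; elim: l O => [|i l IH] O /=; first by case: (A O).
have /andP[q0 q1] := q01 i; have := IH O; have := IH (i |: O); nra.
Qed.

Lemma percolation_prob_anti q A l O O' : (forall i, 0 <= q i <= 1) -> antimonotone A ->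
  O \subset O' -> percolation_prob q A l O' <= percolation_prob q A l O.
Proof.
move=> q01 Aanti; elim: l O O' => [|i l IH] O O' OO' /=.
  by case E: (A O') => //; rewrite (Aanti _ _ OO').
have /andP[q0 q1] := q01 i.
by apply: lerD; apply: ler_wpM2l; rewrite ?subr_ge0 //; apply: IH; rewrite // finset.setUS.
Qed.

Lemma percolation_prob_mono q q' A l O : (forall i, 0 <= q i) -> (forall i, q' i <= 1) ->
  (forall i, q i <= q' i) ->
  antimonotone A -> percolation_prob q A l O <= percolation_prob q' A l O.
Proof.
move=> q0 q1 qq' Aanti; elim: l O => [|i l IH] O //=.
have q01 j : 0 <= q j <= 1 by rewrite q0 (le_trans (qq' j)).
have d : percolation_prob q A l (i |: O) <= percolation_prob q A l O.
  by apply: percolation_prob_anti; rewrite // finset.subsetUr.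
apply: (@le_trans _ _ (q' i * percolation_prob q A l O +
                    (1 - q' i) * percolation_prob q A l (i |: O))).
  by have := qq' i; nra.
apply: lerD; apply: ler_wpM2l => //; last by rewrite subr_ge0.
exact: le_trans (q0 i) (qq' i).
Qed.

(** The left-hand side is the failure probability of the union of two
    independent percolations, which fails only if both of them do. *)
Lemma percolation_prob_mul q q' A l O : (forall i, 0 <= q i <= 1) ->
  (forall i, 0 <= q' i <= 1) -> antimonotone A ->
  percolation_prob (fun i => q i * q' i) A l O <=
    percolation_prob q A l O * percolation_prob q' A l O.
Proof.
move=> q01 q01' Aanti; elim: l O => [|i l IH] O /=.
  by case: (A O); rewrite ?mulr1 ?mulr0.
have := IH O; have := IH (i |: O).
have : percolation_prob q A l (i |: O) <= percolation_prob q A l O.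
  by apply: percolation_prob_anti; rewrite // finset.subsetUr.
have : percolation_prob q' A l (i |: O) <= percolation_prob q' A l O.
  by apply: percolation_prob_anti; rewrite // finset.subsetUr.
have := percolation_prob_ge0 A l (i |: O) q01; have := percolation_prob_ge0 A l (i |: O) q01'.
have /andP[] := q01 i; have /andP[] := q01' i.
set a0 := percolation_prob q A l O; set a1 := percolation_prob q A l _.
set b0 := percolation_prob q' A l O; set b1 := percolation_prob q' A l _.
set c0 := percolation_prob _ A l O; set c1 := percolation_prob _ A l _.
move: (q i) (q' i) => u v v0 v1 u0 u1 b10 a10 ba ab H1 H0.
have uv0 : 0 <= u * v by rewrite mulr_ge0.
have uv1 : 0 <= 1 - u * v by rewrite subr_ge0 mulr_ile1.
(* With [0] for closed and [1] for open, the two percolations agree on the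
   weights of the cases 00 and 11; the difference comes from the cases 01 and
   10, where [a1 <= a0] and [b1 <= b0] apply. *)
apply: (@le_trans _ _ (u * v * (a0 * b0) + (1 - u * v) * (a1 * b1))).
  by apply: lerD; apply: ler_wpM2l.
rewrite -subr_ge0.
have -> : (u * a0 + (1 - u) * a1) * (v * b0 + (1 - v) * b1) -
  (u * v * (a0 * b0) + (1 - u * v) * (a1 * b1)) =
  (u * (1 - v)) * ((a0 - a1) * b1) + ((1 - u) * v) * (a1 * (b0 - b1)) by ring.
by rewrite addr_ge0 // !mulr_ge0 // subr_ge0.
Qed.

Lemma percolation_prob_exp q A l O m : (forall i, 0 <= q i <= 1) -> antimonotone A ->
  percolation_prob (fun i => q i ^+ m) A l O <= percolation_prob q A l O ^+ m.
Proof.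
move=> q01 Aanti; elim: m => [|m IH].
  rewrite expr0; apply: percolation_prob_le1 => i; rewrite expr0 ler01 lexx //.
rewrite exprS; apply: le_trans (ler_wpM2l (percolation_prob_ge0 _ _ _ q01) IH).
under eq_fun do rewrite exprS.
apply: percolation_prob_mul => // i; have /andP[q0 q1] := q01 i.
by rewrite exprn_ge0 ?exprn_ile1.
Qed.

End Percolation.

(** * The second moment method *)

Section SecondMoment.
Variables (R : realType) (I : finType) (q : R).
Hypotheses (q_ge0 : 0 <= q) (q_lt1 : q < 1).

Definition bernoulli_law (i : I) (b : bool) : R := if b then 1 - q else q.

Lemma bernoulli_law_ge0 i b : 0 <= bernoulli_law i b.
Proof. by case: b => //=; rewrite subr_ge0 ltW. Qed.

Lemma bernoulli_law_sum i : \sum_b bernoulli_law i b = 1.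
Proof. by rewrite big_bool /= subrK. Qed.

Lemma expect_open (a : {set I}) :
  expect bernoulli_law (fun s => \prod_(i in a) (s i)%:R) = (1 - q) ^+ #|a|.
Proof.
under eq_expect do rewrite big_mkcond.
rewrite (expect_prod _ (fun i (b : bool) => if i \in a then b%:R else 1)).
rewrite -prodr_const [RHS]big_mkcond; apply: eq_bigr => i _.
by rewrite big_bool /=; case: ifP; rewrite ?mulr1 ?mulr0 ?addr0 ?subrK.
Qed.

(** Each [ed g] is a path of [D] edges, open when all its edges are.  Given that
    the path [g] is open, the path [h] is open with probability
    [(1 - q) ^+ D] divided by [1 - q] for each edge shared with [g]; the
    hypothesis thus makes the second moment of the number of open paths at most
    [K] times its squared mean. *)
Lemma second_moment (T : eqType) (l : seq T) (ed : T -> {set I}) (D : nat) (K : R) :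
  l != [::] -> 0 < K ->
  (forall g, g \in l -> #|ed g| = D) ->
  (forall g, g \in l ->
     \sum_(h <- l) (1 - q)^-1 ^+ #|ed g :&: ed h| <= K * (size l)%:R) ->
  prob bernoulli_law (fun s => all (fun g => ~~ (ed g \subset [set i | s i])) l)
    <= 1 - K^-1.
Proof.
move=> l0 K0 edD over.
set Z := fun s => _.
have p0 : 0 < 1 - q by rewrite subr_gt0.
pose N (s : {ffun I -> bool}) : R := \sum_(g <- l) \prod_(i in ed g) (s i)%:R.
have sl : 0 < (size l)%:R :> R by rewrite ltr0n lt0n size_eq0.
set a : R := (size l)%:R * (1 - q) ^+ D.
have EN : expect bernoulli_law N = a.
  rewrite expect_sum /a mulr_natl.
  rewrite (eq_big_seq (fun=> (1 - q) ^+ D)) => [|g gl].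
    by rewrite big_const_seq count_predT iter_addr_0.
  by rewrite expect_open edD.
have EN2 : expect bernoulli_law (fun s => N s ^+ 2) <= K * a ^+ 2.
  under eq_expect => s do rewrite expr2 /N mulr_suml.
  rewrite expect_sum.
  apply: (@le_trans _ _ (\sum_(g <- l) (1 - q) ^+ D * ((1 - q) ^+ D * (K * (size l)%:R)))); last first.
    rewrite big_const_seq count_predT iter_addr_0 -[_ *+ _]mulr_natl /a.
    by rewrite le_eqVlt; apply/orP; left; apply/eqP; ring.
  rewrite big_seq [X in _ <= X]big_seq; apply: ler_sum => g gl.
  under eq_expect => s do rewrite mulr_sumr.
  rewrite expect_sum.
  apply: le_trans (ler_wpM2l _ (ler_wpM2l _ (over g gl))); rewrite ?exprn_ge0 ?(ltW p0) //.
  rewrite !mulr_sumr le_eqVlt; apply/orP; left; apply/eqP.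
  apply: eq_big_seq => h hl.
  have -> : expect bernoulli_law (fun s => \prod_(i in ed g) (s i)%:R *
     \prod_(i in ed h) (s i)%:R) = (1 - q) ^+ #|ed g :|: ed h|.
    rewrite -expect_open; apply: eq_expect => s.
    rewrite big_mkcond [X in _ * X]big_mkcond -big_split [RHS]big_mkcond /=.
    apply: eq_bigr => i _; rewrite inE.
    by case: (i \in ed g); case: (i \in ed h); case: (s i); rewrite /= ?mulr1 ?mulr0.
  have p0' : 1 - q != 0 by rewrite gt_eqF.
  apply: (mulIf (expf_neq0 #|ed g :&: ed h| p0')).
  rewrite -exprD cardsUI !edD // -!mulrA -exprMn mulVf // expr1n mulr1.
  by rewrite exprD.
have a0 : 0 < a by rewrite mulr_gt0 // exprn_gt0.
(* The expectation of [(N - lam) ^+ 2] on the event [N != 0] is nonnegative.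
   The choice [lam = K * a] makes the bound on that event equal to [K^-1]. *)
have ge (lam : R) : 2 * lam * a - lam ^+ 2 * (1 - prob bernoulli_law Z) <= K * a ^+ 2.
  apply: le_trans EN2.
  have -> : 2 * lam * a - lam ^+ 2 * (1 - prob bernoulli_law Z) =
      expect bernoulli_law (fun s => 2 * lam * N s +
        (lam ^+ 2 * (Z s)%:R + - lam ^+ 2)).
    rewrite 2!expectD 2!expectZ (expect_cst bernoulli_law_sum) EN.
    by rewrite mulrBr mulr1 opprB.
  apply: (ler_expect bernoulli_law_ge0) => s.
  have N0 : Z s -> N s = 0.
    move=> Zs; rewrite /N big_seq big1 // => g gl.
    have /subsetPn[i ig] := allP Zs g gl.
    by rewrite inE => si; rewrite (bigD1 i) //= (negbTE si) mul0r.
  case: (Z s) N0 => [->//|_]; first by rewrite mulr1 mulr0 subrr add0r sqr_ge0.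
  rewrite mulr0 sub0r -subr_ge0.
  by have := sqr_ge0 (N s - lam); rewrite sqrrB -mulr_natl; lra.
have {}ge := ge (K * a).
have : K * a ^+ 2 * (K * (1 - prob bernoulli_law Z)) >= K * a ^+ 2 * 1.
  move: ge; set p := prob _ _ => ge.
  rewrite -subr_ge0.
  have -> : K * a ^+ 2 * (K * (1 - p)) - K * a ^+ 2 * 1 =
    K * a ^+ 2 - (2 * (K * a) * a - (K * a) ^+ 2 * (1 - p)) by ring.
  by rewrite subr_ge0.
rewrite ler_pM2l ?mulr_gt0 ?exprn_gt0 // => H.
by rewrite lerBrDr addrC -lerBrDr -[_^-1]mul1r ler_pdivrMr // mulrC.
Qed.

End SecondMoment.

(** * Elementary inequalities *)

Lemma prodr_seq_le (R : realType) (T : eqType) (l : seq T) (F : T -> R) p :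
  (forall t, t \in l -> 0 <= F t <= p) -> \prod_(t <- l) F t <= p ^+ size l.
Proof.
elim: l => [|t l IH] Fp; first by rewrite big_nil expr0.
have /andP[F0 F1] := Fp t (mem_head _ _); rewrite big_cons exprS.
have Fl u : u \in l -> 0 <= F u <= p by move=> ul; apply: Fp; rewrite inE ul orbT.
rewrite ler_pM ?IH //; rewrite big_seq prodr_ge0 // => u /Fl/andP[].
by [].
Qed.

Section FactorialBounds.
Variable R : realType.
Implicit Types (n g : nat) (x Y : R).

Lemma bernoulli_ineq n x : 0 <= x -> 1 + n%:R * x <= (1 + x) ^+ n.
Proof.
move=> x0; elim: n => [|n IH]; first by rewrite mul0r addr0 expr0.
rewrite exprS; apply: (@le_trans _ _ ((1 + x) * (1 + n%:R * x))).
  have : 0 <= n%:R * x * x by rewrite !mulr_ge0.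
  by rewrite -natr1; lra.
by apply: ler_wpM2l => //; rewrite addr_ge0.
Qed.

(** Bernoulli's inequality for the lower bound, and the value of e being at
    most 4 for the upper bound. *)
Lemma succ_pow_bounds n : (0 < n)%N ->
  2 * n%:R ^+ n <= n.+1%:R ^+ n :> R /\ n.+1%:R ^+ n <= 4 * n%:R ^+ n :> R.
Proof.
move=> n0; have n0' : 0 < n%:R :> R by rewrite ltr0n.
have -> : n.+1%:R = n%:R * (1 + n%:R^-1) :> R.
  by rewrite mulrDr mulr1 mulfV ?gt_eqF // -natr1.
have npow : 0 < n%:R ^+ n :> R by rewrite exprn_gt0.
rewrite exprMn ![_ * n%:R ^+ n]mulrC !ler_pM2l //; split.
  have := @bernoulli_ineq n n%:R^-1; rewrite invr_ge0 ler0n mulfV ?gt_eqF //.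
  by apply.
apply: (@le_trans _ _ (expR n%:R^-1 ^+ n)).
  by rewrite lerXn2r ?nnegrE ?expR_ge0 ?addr_ge0 ?invr_ge0 ?expR_ge1Dx.
rewrite -expRM_natl mulfV ?gt_eqF //.
have h : 2^-1 <= expR (- 2^-1) :> R by have := expR_ge1Dx (- 2^-1 : R); lra.
have -> : expR 1 = (expR (- 2^-1) * expR (- 2^-1))^-1 :> R.
  by rewrite -expRD -expRN; congr expR; lra.
rewrite -[leRHS]invrK lef_pV2 ?posrE ?mulr_gt0 ?expR_gt0 ?invr_gt0 //.
by apply: le_trans (ler_pM _ _ h h) => //; lra.
Qed.

Lemma fact_le_half_pow n : n`!%:R <= 2 * (n%:R / 2) ^+ n :> R.
Proof.
elim: n => [|[|n] IH]; first by rewrite expr0 fact0; lra.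
  by rewrite expr1 factS fact0; lra.
rewrite factS natrM exprS expr_div_n.
have [H _] := succ_pow_bounds (ltn0Sn n).
apply: (@le_trans _ _ (n.+2%:R * (n.+2%:R ^+ n.+1 / 2 ^+ n.+1))); last first.
  by rewrite le_eqVlt; apply/orP; left; apply/eqP; field; rewrite expf_neq0.
apply: ler_wpM2l => //; apply: le_trans IH _.
by rewrite expr_div_n mulrA; apply: ler_wpM2r.
Qed.

Lemma fact_ge_quarter_pow n : (n%:R / 4) ^+ n <= n`!%:R :> R.
Proof.
elim: n => [|[|n] IH]; first by rewrite expr0 fact0.
  by rewrite expr1 factS fact0; lra.
rewrite factS natrM exprS.
have [_ H] := succ_pow_bounds (ltn0Sn n).
rewrite -mulrA; apply: ler_wpM2l => //.
apply: le_trans IH; rewrite !expr_div_n.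
rewrite mulrA ler_wpM2r ?invr_ge0 ?exprn_ge0 //.
by rewrite mulrC ler_pdivrMr // mulrC.
Qed.

Lemma fact_mul_fact_le a b : (a.+1`! * b.+1`! <= (a + b).+1`!)%N.
Proof.
elim: b => [|b IH]; first by rewrite addn0 muln1.
rewrite addnS [b.+2`!]factS [(a + b).+2`!]factS mulnCA leq_mul //.
by rewrite !ltnS leq_addl.
Qed.

Lemma sum_geometric_le (z : R) n : 0 <= z < 1 -> \sum_(i < n) z ^+ i <= (1 - z)^-1.
Proof.
move=> /andP[z0 z1]; have z1' : 0 < 1 - z by rewrite subr_gt0.
rewrite -[leRHS]mul1r ler_pdivlMr // mulrC.
have := subrX1 z n; have := exprn_ge0 n z0; lra.
Qed.

(** The two extreme terms contribute [n`!] each, and each of the others is at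
    most [n.-1`!]; there are fewer than [n] of the latter. *)
Lemma sum_fact_mul_fact n :
  (\sum_(g < n.+1) g`! * (n - g)`! <= 3 * n`!)%N.
Proof.
case: n => [|[|n]]; first by rewrite big_ord_recl big_ord0.
  by rewrite !big_ord_recl big_ord0.
rewrite big_ord_recl big_ord_recr /=.
rewrite fact0 mul1n /bump /= subn0 subnn fact0 muln1.
have -> : (3 * n.+2`! = n.+2`! + (n.+2`! + n.+2`!))%N by lia.
rewrite leq_add2l leq_add2r.
apply: (@leq_trans (\sum_(g < n.+1) n.+1`!)); last first.
  by rewrite sum_nat_const card_ord [leqRHS]factS leq_mul2r leqnSn orbT.
apply: leq_sum => g _; have gn : (g <= n)%N by rewrite -ltnS.
rewrite add1n subSS subSn //.
by have := fact_mul_fact_le g (n - g); rewrite subnKC.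
Qed.

Lemma fact_le_pow n Y : n%:R <= Y -> n`!%:R <= Y ^+ n.
Proof.
elim: n => [|n IH] nY; first by rewrite fact0 expr0.
rewrite factS natrM exprS ler_pM // IH //.
by apply: le_trans nY; rewrite ler_nat.
Qed.

(** The terms decrease and then increase with [g], so that the sum is comparable
    to its first term [Y ^+ n] plus one more term [n`!] at the far end. *)
Lemma sum_fact_pow n Y : 0 < Y ->
  \sum_(g < n) g`!%:R * Y ^+ (n - g) <= 6 * (Y ^+ n + n`!%:R).
Proof.
move=> Y0; elim: n => [|n IH]; first by rewrite big_ord0 expr0 fact0; lra.
have YX m : 0 < Y ^+ m by rewrite exprn_gt0.
(* For [n.+1 >= 7 Y / 6] the factorial grows fast enough for the induction;
   below this threshold the sum is at most geometric of ratio 7/12. *)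
have [nY|nY] := lerP (7 * Y) (6 * n.+1%:R).
  rewrite big_ord_recr /= subSnn expr1.
  under eq_bigr => g _ do rewrite subSn ?(ltnW (ltn_ord g)) // exprS mulrCA.
  rewrite -mulr_sumr factS natrM exprS.
  have := ler_wpM2l (ltW Y0) IH.
  have : 0 <= (6 * n.+1%:R - 7 * Y) * n`!%:R by rewrite mulr_ge0 // subr_ge0.
  nra.
have -> : 6 * (Y ^+ n.+1 + (n.+1)`!%:R) = 6 * Y ^+ n.+1 + 6 * (n.+1)`!%:R.
  by rewrite mulrDr.
apply: ler_wpDr; first by rewrite mulr_ge0.
apply: (@le_trans _ _ (\sum_(g < n.+1) 2 * Y ^+ n.+1 * (7 / 12) ^+ g)).
  apply: ler_sum => g _.
  have gn : (g <= n.+1)%N by rewrite ltnW.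
  apply: (@le_trans _ _ (2 * (g%:R / 2) ^+ g * Y ^+ (n.+1 - g))).
    by apply: ler_wpM2r; [rewrite ltW | apply: fact_le_half_pow].
  have -> : 2 * Y ^+ n.+1 * (7 / 12) ^+ g =
     2 * (7 / 12 * Y) ^+ g * Y ^+ (n.+1 - g).
    move: (7 / 12) => z.
    by rewrite exprMn -!mulrA -exprD subnKC // [Y ^+ _ * _]mulrC.
  apply: ler_wpM2r; first by rewrite ltW.
  apply: ler_wpM2l => //; apply: lerXn2r; rewrite ?nnegrE ?divr_ge0 ?mulr_ge0 ?(ltW Y0) //.
  have : g%:R <= n.+1%:R :> R by rewrite ler_nat.
  lra.
rewrite -mulr_sumr mulrAC; apply: ler_wpM2r; first by rewrite ltW.
have /(@sum_geometric_le _ n.+1) : (0 <= 7 / 12 :> R) && (7 / 12 < 1 :> R) by apply/andP; split; lra.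
have -> : (1 - 7 / 12)^-1 = 12 / 5 :> R by field.
lra.
Qed.

(** Bound on the total penalty of the orders of [n] elements against a fixed one,
    when a shared edge costs [Y / 24] more than an edge which is not shared.
    The term [n`!] stands for the pairs sharing few edges, and the term [Y ^+ n]
    for those that share most of them. *)
Definition overlap_bound Y n : R := 2 * (n`!%:R + Y ^+ n).

(** The recursion obtained by cutting an order at the first marked shared edge:
    there are [g`!] ways to order the elements before it, the mark costs [x],
    and [n - g.+1] elements remain. *)
Lemma overlap_bound_rec x n : 0 < x ->
  n`!%:R + x * (\sum_(g < n) g`!%:R * overlap_bound (24 * x) (n - g.+1)) <=
    overlap_bound (24 * x) n.
Proof.
move=> x0; set Y := 24 * x; have Y0 : 0 < Y by rewrite mulr_gt0.
case: n => [|m]; first by rewrite big_ord0 mulr0 /overlap_bound expr0 fact0; lra.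
have S1 : \sum_(g < m.+1) g`!%:R * (m - g)`!%:R <= 3 * m`!%:R :> R.
  rewrite -[3 * _]natrM; apply: le_trans (_ : (\sum_(g < m.+1) g`! * (m - g)`!)%:R <= _).
    by rewrite natr_sum; under [leRHS]eq_bigr do rewrite natrM.
  by rewrite ler_nat sum_fact_mul_fact.
have S2 : \sum_(g < m.+1) g`!%:R * Y ^+ (m - g) <= 6 / Y * (Y ^+ m.+1 + m.+1`!%:R).
  rewrite mulrAC ler_pdivlMr // mulr_suml.
  apply: le_trans (sum_fact_pow m.+1 Y0); apply: ler_sum => g _.
  by rewrite -mulrA -exprSr subSn // -ltnS.
have -> : \sum_(g < m.+1) g`!%:R * overlap_bound Y (m.+1 - g.+1) =
   2 * (\sum_(g < m.+1) g`!%:R * (m - g)`!%:R +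
        \sum_(g < m.+1) g`!%:R * Y ^+ (m - g)).
  rewrite -big_split mulr_sumr; apply: eq_bigr => g _.
  by rewrite subSS /overlap_bound mulrCA mulrDr.
have {}S2 : x * (2 * \sum_(g < m.+1) g`!%:R * Y ^+ (m - g)) <=
   2^-1 * (Y ^+ m.+1 + m.+1`!%:R).
  have -> : 2^-1 * (Y ^+ m.+1 + m.+1`!%:R) =
     x * (2 * (6 / Y * (Y ^+ m.+1 + m.+1`!%:R))).
    by rewrite /Y; field; rewrite gt_eqF.
  by apply: ler_wpM2l; [rewrite ltW | apply: ler_wpM2l].
have {}S1 : x * (2 * \sum_(g < m.+1) g`!%:R * (m - g)`!%:R) <= Y / 4 * m`!%:R.
  have -> : Y / 4 * m`!%:R = x * (2 * (3 * m`!%:R)) by rewrite /Y; field.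
  by apply: ler_wpM2l; [rewrite ltW | apply: ler_wpM2l].
have S3 : Y / 4 * m`!%:R <= 2^-1 * m.+1`!%:R + 4^-1 * Y ^+ m.+1.
  have YX k : 0 < Y ^+ k by rewrite exprn_gt0.
  have f0 : 0 <= m`!%:R :> R by [].
  have [mY|mY] := lerP (Y / 2) m.+1%:R.
    rewrite factS natrM; have := ler_wpM2r f0 mY; have := YX m.+1; nra.
  have : m`!%:R <= Y ^+ m.
    apply: fact_le_pow; have : m%:R <= m.+1%:R :> R by rewrite ler_nat.
    lra.
  rewrite exprS; have : 0 <= m.+1`!%:R :> R by [].
  move=> f1 /(ler_wpM2l (ltW Y0)); nra.
rewrite /overlap_bound; have : 0 <= Y ^+ m.+1 by rewrite exprn_ge0 // ltW.
have : 0 <= m.+1`!%:R :> R by [].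
lra.
Qed.

End FactorialBounds.

(** * Overlap of two orders *)

Section Orders.
Variables (R : realType) (J I : finType) (U : {set J}) (eps : {set J} -> J -> I).
Implicit Types (B : {set J}) (p g : seq J).

(** The ways to flip one by one the coordinates of [U] that are not in [B]; the
    argument [n] should be the number of these coordinates. *)
Fixpoint orders n B : seq (seq J) :=
  if n is n'.+1
  then flatten [seq [seq b :: p | p <- orders n' (b |: B)] | b <- enum (U :\: B)]
  else [:: [::]].

(** The edges of the path that starts at the vertex [B] of the cube and flips the
    coordinates of [p] in turn; [eps B b] is the edge between the vertices [B]
    and [b |: B]. *)
Fixpoint order_edges B p : seq I :=
  if p is b :: p' then eps B b :: order_edges (b |: B) p' else [::].

Lemma sum_orders n B (F : seq J -> R) :
  \sum_(p <- orders n.+1 B) F p =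
  \sum_(b in U :\: B) \sum_(p <- orders n (b |: B)) F (b :: p).
Proof.
rewrite /= big_flatten big_map big_enum /=.
by apply: eq_bigr => b _; rewrite big_map.
Qed.

Lemma mem_orders n B p : p \in orders n B ->
  [/\ size p = n, uniq p & {subset p <= U :\: B}].
Proof.
elim: n B p => [|n IH] B p /=; first by rewrite inE => /eqP->.
move=> /flatten_mapP[b]; rewrite mem_enum => bUB /mapP[p' /IH[sp up subp] ->] /=.
split; first by rewrite sp.
  by rewrite up andbT; apply/negP => /subp; rewrite !inE eqxx.
move=> c; rewrite inE => /predU1P[->//|/subp].
by rewrite !inE negb_or => /andP[/andP[_ ->] ->].
Qed.

Lemma card_setDU1 n B b : b \in U :\: B -> #|U :\: B| = n.+1 ->
  #|U :\: (b |: B)| = n.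
Proof.
move=> bUB; rewrite (cardsD1 b) bUB add1n => -[<-]; apply: eq_card => c.
by rewrite !inE negb_or andbA.
Qed.

Lemma size_orders n B : #|U :\: B| = n -> (size (orders n B))%:R = n`!%:R :> R.
Proof.
have sizeE T (l : seq T) : (size l)%:R = \sum_(t <- l) 1 :> R.
  by rewrite big_const_seq count_predT iter_addr_0.
elim: n B => [|n IH] B cB //.
rewrite sizeE sum_orders (eq_bigr (fun=> n`!%:R)) => [|b bUB].
  by rewrite sumr_const cB factS natrM mulr_natl.
by rewrite -sizeE IH //; apply: card_setDU1.
Qed.

Lemma subset_setDU1 B b p : b \notin p -> {subset b :: p <= U :\: B} ->
  {subset p <= U :\: (b |: B)}.
Proof.
move=> bp sp c cp; have := sp c; rewrite inE cp orbT => /(_ isT).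
rewrite !inE => /andP[/negbTE-> ->]; rewrite orbF andbT.
by apply: contraNneq bp => <-.
Qed.

Lemma order_edgesP B p e : e \in order_edges B p -> uniq p ->
    {subset p <= U :\: B} ->
  exists j b, [/\ (j < size p)%N, e = eps (B :|: [set x in take j p]) b,
     b \in U :\: (B :|: [set x in take j p]) &
     b |: (B :|: [set x in take j p]) = B :|: [set x in take j.+1 p]].
Proof.
elim: p B => [|b p IH] B //=; rewrite inE => /predU1P[->|ep] /andP[bp up] sp.
  have E0 : B :|: [set x in [::]] = B by apply/setP => x; rewrite !inE orbF.
  exists 0%N, b; rewrite !take0 E0; split => //; first by apply: sp; rewrite mem_head.
  by apply/setP => x; rewrite !inE orbC.
have sp' := subset_setDU1 bp sp.
have [j [c [jp -> cU cE]]] := IH _ ep up sp'.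
have E k : b |: B :|: [set x in take k p] = B :|: [set x in b :: take k p].
  by apply/setP => x; rewrite !inE orbCA orbA.
by exists j.+1, c; rewrite -!E; split.
Qed.

Hypothesis eps_inj : forall B B' b b', B \subset U -> B' \subset U ->
  b \in U :\: B -> b' \in U :\: B' -> eps B b = eps B' b' -> B = B' /\ b = b'.

Lemma uniq_order_edges B p : B \subset U -> uniq p -> {subset p <= U :\: B} ->
  uniq (order_edges B p).
Proof.
elim: p B => [|b p IH] B //= BU /andP[bp up] sp.
have bUB : b \in U :\: B by apply: sp; rewrite mem_head.
have sp' := subset_setDU1 bp sp.
have bBU : b |: B \subset U.
  by rewrite finset.subUset finset.sub1set BU andbT; move: bUB; rewrite inE => /andP[].
rewrite IH // andbT; apply/negP => /order_edgesP/(_ up sp')[j [c [jp eE cU _]]].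
have [|] := eps_inj BU _ bUB cU eE.
  apply/fintype.subsetP => y; rewrite finset.in_setU => /orP[/(fintype.subsetP bBU)//|].
  by rewrite inE => /mem_take /sp'; rewrite inE => /andP[].
by move=> /setP/(_ b); rewrite !inE eqxx; move: bUB; rewrite inE => /andP[/negbTE->].
Qed.

Section Overlap.
Variables (x : R) (g : seq J).
Hypotheses (x_gt0 : 0 < x) (g_uniq : uniq g) (gU : {subset g <= U}).
Hypothesis size_g : size g = #|U|.

Let D := #|U|.
Let chain j : {set J} := [set y in take j g].
Let H := overlap_bound (24 * x).

Let chain_sub j : chain j \subset U.
Proof. by apply/fintype.subsetP => y; rewrite inE => /mem_take/gU. Qed.

Let card_chain j : (j <= D)%N -> #|chain j| = j.
Proof.
by move=> jD; rewrite cardsE (card_uniqP _) ?take_uniq // size_takel // size_g.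
Qed.

Let H_ge0 n : 0 <= H n.
Proof.
by rewrite /H /overlap_bound !mulr_ge0 // addr_ge0 // exprn_ge0 // mulr_ge0 // ltW.
Qed.

Let overlap_sum n B : R := n`!%:R +
  x * \sum_(j < D | B \subset chain j) (j - #|B|)`!%:R * H (D - j.+1).

Let overlap_sum_chain i : (i <= D)%N -> overlap_sum (D - i) (chain i) <= H (D - i).
Proof.
move=> iD; apply: le_trans (overlap_bound_rec (D - i) x_gt0).
rewrite lerD2l ler_pM2l // card_chain //.
apply: (@le_trans _ _ (\sum_(j < D | (i <= j)%N) (j - i)`!%:R * H (D - j.+1))).
  rewrite [leLHS]big_mkcond [leRHS]big_mkcond; apply: ler_sum => j _.
  case: ifP => [sub|_]; last by case: ifP => // _; rewrite mulr_ge0.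
  have -> // : (i <= j)%N.
  by rewrite -(card_chain iD) -(card_chain (ltnW (ltn_ord j))) subset_leq_card.
have -> : \sum_(j < D | (i <= j)%N) (j - i)`!%:R * H (D - j.+1) =
    \sum_(i <= j < D) (j - i)`!%:R * H (D - j.+1) by rewrite big_geq_mkord.
rewrite -{1}[i]add0n big_addn big_mkord le_eqVlt; apply/orP; left; apply/eqP.
apply: eq_bigr => j _; rewrite addnK -/H; congr (_ * H _); lia.
Qed.

(** Expand the product into a sum over the sets of marked shared edges, each mark
    costing [x].  The first mark sits at some step [j] of the path [g], and the path
    from [B] must pass through the vertex [chain j], which it can reach in
    [(j - #|B|)`!] ways; after the mark it continues from [chain j.+1].  The
    induction moves the first path by one step; a mark at that very step is
    possible only if [B] is on the path [g]. *)
Lemma overlap_le n B : B \subset U -> #|U :\: B| = n ->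
  \sum_(p <- orders n B) \prod_(e <- order_edges B p)
     (1 + x * (e \in order_edges finset.set0 g)%:R) <= overlap_sum n B.
Proof.
elim: n B => [|n IH] B BU cB.
  rewrite /= big_seq1 big_nil /overlap_sum fact0 lerDl mulr_ge0 ?(ltW x_gt0) //.
  by apply: sumr_ge0 => j _; rewrite mulr_ge0.
have cBD : (#|B| + n.+1 = D)%N.
  by rewrite -cB /D -(cardsID B U) (finset.setIidPr BU).
set i := #|B|; have iD : (i < D)%N by lia.
have bBU b : b \in U :\: B -> b |: B \subset U.
  by rewrite finset.subUset finset.sub1set BU andbT inE => /andP[].
have card_bB b : b \in U :\: B -> #|b |: B| = i.+1.
  by rewrite inE cardsU1 => /andP[-> _].
pose hit b := eps B b \in order_edges finset.set0 g.
have gU0 : {subset g <= U :\: finset.set0} by move=> y /gU; rewrite finset.setD0.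
have hitP b : b \in U :\: B -> hit b -> B = chain i /\ b |: B = chain i.+1.
  move=> bUB /order_edgesP/(_ g_uniq gU0)[j [c [jg E cU cE]]].
  rewrite !finset.set0U -/(chain j) -/(chain j.+1) in E cU cE.
  have [eB eb] := eps_inj BU (chain_sub j) bUB cU E.
  have jD : (j < D)%N by rewrite /D -size_g.
  have -> : i = j by rewrite /i eB card_chain // ltnW.
  by rewrite -cE eb -eB.
have step b : b \in U :\: B ->
    \sum_(p <- orders n (b |: B)) \prod_(e <- order_edges B (b :: p))
      (1 + x * (e \in order_edges finset.set0 g)%:R) <=
    overlap_sum n (b |: B) + x * (hit b)%:R * H (D - i.+1).
  move=> bUB; under eq_bigr do rewrite /= big_cons -/(hit b).
  rewrite -mulr_sumr; have := IH (b |: B) (bBU _ bUB) (card_setDU1 bUB cB).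
  case hb: (hit b) => S; last by rewrite !mulr0 mul0r !addr0 mul1r.
  rewrite !mulr1 mulrDl mul1r; apply: lerD => //.
  apply: ler_wpM2l; first exact: ltW.
  apply: le_trans S _; have [_ ->] := hitP _ bUB hb.
  have -> : n = (D - i.+1)%N by lia.
  exact: overlap_sum_chain.
rewrite sum_orders; apply: (@le_trans _ _ (\sum_(b in U :\: B)
  (overlap_sum n (b |: B) + x * (hit b)%:R * H (D - i.+1)))).
  by apply: ler_sum => b; apply: step.
rewrite big_split /=.
have -> : \sum_(b in U :\: B) overlap_sum n (b |: B) = n.+1`!%:R +
    x * \sum_(j < D | B \subset chain j)
      (j - i)%:R * (j - i.+1)`!%:R * H (D - j.+1).
  rewrite big_split /= sumr_const cB factS natrM mulr_natl; congr (_ + _).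
  rewrite -mulr_sumr; congr (_ * _).
  rewrite (exchange_big_dep (fun j : 'I_D => B \subset chain j)) /=; last first.
    by move=> b j _; rewrite finset.subUset => /andP[].
  apply: eq_bigr => j Bj.
  rewrite (eq_bigl (fun b => b \in chain j :\: B)) => [|b]; last first.
    rewrite finset.subUset finset.sub1set Bj andbT !inE -andbA; congr andb.
    by apply: andb_idl => /mem_take/gU.
  rewrite (eq_bigr (fun=> (j - i.+1)`!%:R * H (D - j.+1))) => [|b]; last first.
    rewrite inE => /andP[bB bj]; rewrite card_bB // inE bB.
    exact: (fintype.subsetP (chain_sub j)).
  have cjB : #|chain j :\: B| = (j - i)%N.
    have := cardsID B (chain j).
    rewrite (finset.setIidPr Bj) card_chain ?(ltnW (ltn_ord j)) // -/i; lia.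
  by rewrite sumr_const cjB -[_ *+ (j - i)]mulr_natl mulrA.
have -> : \sum_(b in U :\: B) x * (hit b)%:R * H (D - i.+1) =
    x * ((\sum_(b in U :\: B) (hit b)%:R) * H (D - i.+1)).
  by rewrite -mulr_suml -mulr_sumr mulrA.
rewrite /overlap_sum -addrA lerD2l -mulrDr ler_pM2l //.
(* At most one step from [B] follows the path [g]. *)
have hits : \sum_(b in U :\: B) (hit b)%:R <= (B == chain i)%:R :> R.
  case: (pickP [pred b | (b \in U :\: B) && hit b]) => [b0 /= /andP[b0U hb0]|no].
    have [<- E0] := hitP _ b0U hb0; rewrite eqxx (bigD1 b0) //= hb0 big1 ?addr0 //.
    move=> b /andP[bU bb0]; case hb: (hit b) => //.
    have [_ E] := hitP _ bU hb; move: E; rewrite -E0 => /setP/(_ b).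
    rewrite !inE eqxx (negbTE bb0) /=; move: bU; rewrite inE => /andP[/negbTE->].
    by [].
  by rewrite big1 // => b bU; have := no b; rewrite /= bU /= => ->.
have factE m : m%:R * m.-1`!%:R <= m`!%:R :> R.
  by rewrite -natrM ler_nat; case: m => // m; rewrite factS.
apply: (@le_trans _ _ (\sum_(j < D | B \subset chain j)
      (j - i)%:R * (j - i.+1)`!%:R * H (D - j.+1) + (B == chain i)%:R * H (D - i.+1))).
  by rewrite lerD2l ler_wpM2r.
have term (j : 'I_D) : (j - i)%:R * (j - i.+1)`!%:R * H (D - j.+1) <=
    (j - i)`!%:R * H (D - j.+1) by rewrite ler_wpM2r // subnS factE.
(* If [B] is on the path [g], the term [j = i], which vanishes on the left,
   accounts for the mark at the current step. *)
have [Bi|_] := eqVneq B (chain i); last first.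
  by rewrite mul0r addr0; apply: ler_sum => j _.
have Bsub : B \subset chain i by rewrite -Bi.
rewrite mul1r (bigD1 (Ordinal iD)) //= subnn !mul0r add0r.
rewrite [leRHS](bigD1 (Ordinal iD)) //= -/i subnn fact0 mul1r [leLHS]addrC lerD2l.
by apply: ler_sum => j _.
Qed.

Lemma overlap_full : \sum_(p <- orders D finset.set0) \prod_(e <- order_edges finset.set0 p)
     (1 + x * (e \in order_edges finset.set0 g)%:R) <= H D.
Proof.
apply: le_trans (overlap_le (finset.sub0set _) _) _; first by rewrite finset.setD0.
have := overlap_sum_chain (leq0n D); rewrite subn0.
suff -> : chain 0 = finset.set0 by [].
by apply/setP => y; rewrite !inE take0.
Qed.

End Overlap.
End Orders.

(** * Crossing a cube *)

Section Crossing.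
Variables (R : realType) (J I : finType) (U : {set J}) (eps : {set J} -> J -> I).
Hypothesis eps_inj : forall (B B' : {set J}) b b', B \subset U -> B' \subset U ->
  b \in U :\: B -> b' \in U :\: B' -> eps B b = eps B' b' -> B = B' /\ b = b'.

Let D := #|U|.
Let paths := orders U D finset.set0.
Let edges_of p : {set I} := [set e in order_edges eps finset.set0 p].

Definition blocked (O : {set I}) : bool :=
  all (fun p => ~~ (edges_of p \subset O)) paths.

Lemma blocked_anti : antimonotone blocked.
Proof.
move=> O O' OO' /allP bl; apply/allP => p /bl; apply: contra => pO.
exact: fintype.subset_trans pO OO'.
Qed.

Lemma blocked0 O : D = 0%N -> blocked O = false.
Proof.
rewrite /blocked /paths => -> /=; rewrite andbT; apply/negbTE; rewrite negbK.
by apply/fintype.subsetP => e; rewrite inE.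
Qed.

Lemma paths_props p : p \in paths ->
  [/\ size p = D, uniq p, {subset p <= U} & uniq (order_edges eps finset.set0 p)].
Proof.
move=> /mem_orders[sp up subp]; split => //.
  by move=> y /subp; rewrite finset.setD0.
by apply: (uniq_order_edges eps_inj); rewrite ?finset.sub0set.
Qed.

(** With [p] the opening probability, a shared edge is penalised by
    [p^-1 = 1 + x], where [x] is at most [D / 96]; the bound on the overlaps is
    then at most [4 * D`!] because [(D / 4) ^+ D <= D`!]. *)
Lemma blocked_bernoulli : (0 < D)%N ->
  prob (bernoulli_law (expR (- (96 / D%:R) : R)))
    (fun s : {ffun I -> bool} => blocked [set i | s i])
    <= 3 / 4.
Proof.
move=> D0; have D0' : 0 < D%:R :> R by rewrite ltr0n.
set t : R := 96 / D%:R; have t0 : 0 < t by rewrite divr_gt0.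
set q := expR (- t).
have q0 : 0 <= q by exact: expR_ge0.
have q1 : q < 1 by rewrite expR_lt1 oppr_lt0.
have p0 : 0 < 1 - q by rewrite subr_gt0.
set x := (1 - q)^-1 - 1.
have x0 : 0 < x.
  by rewrite subr_gt0 invf_gt1 // ltrBlDr ltrDl expR_gt0.
have xt : 24 * x <= D%:R / 4.
  have q_le : q <= (1 + t)^-1.
    by rewrite /q expRN lef_pV2 ?posrE ?expR_gt0 ?addr_gt0 ?expR_ge1Dx.
  have xt : x <= t^-1.
    rewrite lerBlDr -[leRHS]invrK lef_pV2 ?posrE //; last first.
      by rewrite invr_gt0 addr_gt0 // invr_gt0.
    rewrite lerBrDr -lerBrDl; apply: le_trans q_le _.
    rewrite le_eqVlt; apply/orP; left; apply/eqP; field.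
    by rewrite !gt_eqF ?addr_gt0.
  have : t^-1 = D%:R / 96 by rewrite /t invf_div.
  lra.
have := @second_moment R I q q0 q1 _ paths edges_of D 4.
have -> : 1 - 4^-1 = 3 / 4 :> R by lra.
apply => //.
- apply/eqP => pe; have := @size_orders R J U D finset.set0.
  rewrite finset.setD0 -/paths pe => /(_ erefl) /eqP.
  by rewrite eqr_nat eq_sym -leqn0 leqNgt fact_gt0.
- move=> g /paths_props[sg _ _ ug]; rewrite cardsE (card_uniqP _) // -[RHS]sg.
  by elim: (g) (finset.set0) => //= b p IH B; rewrite IH.
move=> g gp; have [sg ug gU uge] := paths_props gp.
rewrite size_orders ?finset.setD0 //.
apply: (@le_trans _ _ (overlap_bound (24 * x) D)).
  apply: le_trans (overlap_full eps_inj x0 ug gU sg).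
  rewrite big_seq [leRHS]big_seq; apply: ler_sum => h /paths_props[_ _ _ uh].
  rewrite le_eqVlt; apply/orP; left; apply/eqP.
  have -> : \prod_(e <- order_edges eps finset.set0 h)
      (1 + x * (e \in order_edges eps finset.set0 g)%:R) =
    \prod_(e in edges_of h) (if e \in edges_of g then (1 - q)^-1 else 1).
    rewrite (big_uniq _ uh); apply: eq_big => e; rewrite !inE // => _.
    by case: ifP => _; rewrite ?mulr1 ?mulr0 ?addr0 // /x addrC subrK.
  rewrite -big_mkcondr prodr_const; congr (_ ^+ _); apply: eq_card => e.
  by rewrite finset.in_setI [RHS]unfold_in andbC.
rewrite /overlap_bound.
have : (24 * x) ^+ D <= D`!%:R.
  apply: le_trans (fact_ge_quarter_pow R D); apply: lerXn2r => //;
    by rewrite nnegrE ?divr_ge0 ?mulr_ge0 // ltW.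
lra.
Qed.

Variables (S : finType) (mu : I -> S -> R).
Hypotheses (mu_ge0 : forall i x, 0 <= mu i x) (mu_sum : forall i, \sum_x mu i x = 1).

(** By monotonicity, every edge may be assumed to be closed with probability
    exactly the [m]-th power of the probability in [blocked_bernoulli], and
    [percolation_prob_exp] applies. *)
Lemma blocked_pow (op : I -> pred S) m :
  (forall i, \sum_(x | ~~ op i x) mu i x <= expR (- (m%:R * 96 / D%:R))) ->
  prob mu (fun s => blocked [set i | op i (s i)]) <= (3 / 4) ^+ m.
Proof.
move=> closed.
have [D0|D0] := posnP D.
  apply: (@le_trans _ _ 0); last by rewrite exprn_ge0 // divr_ge0.
  rewrite /prob -(expect_cst mu_sum 0); apply: ler_expect => // s.
  by rewrite blocked0.
have D0' : 0 < D%:R :> R by rewrite ltr0n.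
set q : R := expR (- (96 / D%:R)).
have q0 : 0 <= q by exact: expR_ge0.
have q1 : q < 1 by rewrite expR_lt1 oppr_lt0 divr_gt0.
have q01 (i : I) : 0 <= q <= 1 by rewrite q0 ltW.
have setE T (o : T -> I -> bool) (s : T) :
    finset.set0 :|: [set i in enum I | o s i] = [set i | o s i].
  by apply/setP => i; rewrite !inE mem_enum.
have -> : prob mu (fun s => blocked [set i | op i (s i)]) =
    percolation_prob (fun i => \sum_(x | ~~ op i x) mu i x) blocked (enum I) finset.set0.
  rewrite -prob_percolation ?enum_uniq //; apply: eq_expect => s.
  by rewrite (setE _ (fun s i => op i (s i))).
apply: (@le_trans _ _ (percolation_prob (fun=> q ^+ m) blocked (enum I) finset.set0)).
  apply: percolation_prob_mono; last exact: blocked_anti.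
  - by move=> i; apply: sumr_ge0.
  - by move=> i; rewrite exprn_ile1 // ltW.
  - move=> i; apply: le_trans (closed i) _.
    by rewrite -expRM_natl mulrN mulrA.
apply: le_trans (percolation_prob_exp _ _ _ q01 blocked_anti) _.
apply: lerXn2r; rewrite ?nnegrE ?percolation_prob_ge0 ?divr_ge0 //.
apply: le_trans (blocked_bernoulli D0); rewrite -/q.
have -> : (fun s : {ffun I -> bool} => blocked [set i | s i]) =
  (fun s => blocked (finset.set0 :|: [set i in enum I | id (s i)])).
  by apply/funext => s; rewrite (setE _ (fun s i => id (s i))).
rewrite (prob_percolation (fun _ => id)) ?enum_uniq //.
- rewrite le_eqVlt; apply/orP; left; apply/eqP; congr (percolation_prob _ _ _ _).
  by apply/funext => i; rewrite big_mkcond big_bool /= add0r.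
- exact: bernoulli_law_ge0.
- exact: bernoulli_law_sum.
Qed.

Variables (W : S -> R) (M : nat).
Hypothesis tail : forall i (t : R), 0 <= t -> \sum_(x | t < W x) mu i x <= expR (- t).
Hypothesis W_le : forall x, W x * D%:R <= M%:R * 96.

Definition slow m (s : {ffun I -> S}) : bool :=
  blocked [set i | W (s i) <= m%:R * 96 / D%:R].

(** A discretised crossing time, in units of 96: the number of unsuccessful
    attempts at the levels [0, 1, ..., M - 1].  Level [M] always succeeds. *)
Definition crossing_time (s : {ffun I -> S}) : R :=
  96 * \sum_(m < M) (slow m s)%:R.

Lemma crossing_time_ge0 s : 0 <= crossing_time s.
Proof. by rewrite mulr_ge0 // sumr_ge0. Qed.

Lemma expect_crossing_time : expect mu crossing_time <= 384.
Proof.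
rewrite expectZ expect_sum.
have -> : 384 = 96 * 4 :> R by lra.
apply: ler_wpM2l => //.
apply: (@le_trans _ _ (\sum_(m < M) (3 / 4) ^+ m)).
  apply: ler_sum => m _; apply: (@blocked_pow (fun _ x => W x <= m%:R * 96 / D%:R)).
  move=> i; apply: le_trans (tail i _); last by rewrite divr_ge0 ?mulr_ge0.
  by rewrite le_eqVlt; apply/orP; left; apply/eqP; apply: eq_bigl => x; rewrite ltNge.
have z1 : (0 <= 3 / 4 :> R) && (3 / 4 < 1 :> R) by apply/andP; split; lra.
apply: le_trans (sum_geometric_le M z1) _.
have -> : 1 - 3 / 4 = 4^-1 :> R by lra.
by rewrite invrK.
Qed.

Lemma crossing_timeP (s : {ffun I -> S}) : exists2 p, p \in paths &
  \sum_(e <- order_edges eps finset.set0 p) W (s e) <= crossing_time s.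
Proof.
have slowM : ~~ slow M s.
  have [D0|D0] := posnP D; first by rewrite /slow blocked0.
  have D0' : 0 < D%:R :> R by rewrite ltr0n.
  rewrite /slow -has_predC; apply/hasP.
  have : (0 < size paths)%N.
    by rewrite -(ltr0n R) size_orders ?finset.setD0 // ltr0n fact_gt0.
  move: paths => [//|p l] _; exists p; first exact: mem_head.
  rewrite /= negbK; apply/fintype.subsetP => e _.
  by rewrite inE ler_pdivlMr.
have ex : exists m, ~~ slow m s by exists M.
case: (ex_minnP ex) => m nslow mmin.
have mM : (m <= M)%N := mmin _ slowM.
have mle : m%:R <= \sum_(i < M) (slow i s)%:R :> R.
  rewrite -[m in leLHS]card_ord -sumr_const (big_ord_widen _ (fun=> 1) mM) big_mkcond.
  apply: ler_sum => i _; case: ifP => // im.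
  by case E: (slow i s) => //; have := mmin i; rewrite E => /(_ isT); lia.
move: nslow; rewrite /slow -has_predC => /hasP[p pp] /=; rewrite negbK => /fintype.subsetP open.
exists p => //; apply: (@le_trans _ _ (96 * m%:R)); last by apply: ler_wpM2l.
have [sp _ _ _] := paths_props pp.
have se : size (order_edges eps finset.set0 p) = D.
  by rewrite -sp; elim: (p) (finset.set0) => //= b l IH B; rewrite IH.
apply: (@le_trans _ _ (\sum_(e <- order_edges eps finset.set0 p) m%:R * 96 / D%:R)).
  rewrite big_seq [leRHS]big_seq; apply: ler_sum => e ep.
  by have := open e; rewrite !inE => /(_ ep).
rewrite big_const_seq count_predT iter_addr_0 se -[_ *+ D]mulr_natl.
have [->|D0] := posnP D; first by rewrite mul0r mulr_ge0.
by rewrite mulrC divfK ?pnatr_eq0 -?lt0n // mulrC.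
Qed.

Lemma crossing_time_depends (A : pred I) :
  (forall p e, p \in paths -> e \in order_edges eps finset.set0 p -> A e) ->
  depends_on A crossing_time.
Proof.
move=> pA s t st; rewrite /crossing_time; congr (_ * _); apply: eq_bigr => m _.
congr (nat_of_bool _)%:R; apply: eq_in_all => p pp; congr (~~ _).
apply/fintype.subsetP/fintype.subsetP => H e ep; have := H e ep; rewrite !inE st //;
  by apply: (pA p) => //; rewrite inE in ep.
Qed.

End Crossing.

(** * Passage times along walks *)

Section Reach.
Variables (R : realType) (V : finType) (adj : rel V) (w : {set V} -> R).

(** Walks may repeat vertices here, so that they can be concatenated;
    [reach_simple] goes back to simple paths. *)
Definition reach (x y : V) (r : R) : Prop :=
  exists p, [/\ path adj x p, last x p = y & path_time w x p <= r].

Lemma path_time_cat x p q :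
  path_time w x (p ++ q) = path_time w x p + path_time w (last x p) q.
Proof. by rewrite /path_time /path_edges pairmap_cat big_cat. Qed.

Lemma path_time_cons x y p :
  path_time w x (y :: p) = w [set x; y]%SET + path_time w y p.
Proof. by rewrite /path_time /= big_cons. Qed.

Lemma reach_le x y r r' : r <= r' -> reach x y r -> reach x y r'.
Proof. by move=> rr' [p [xp py pr]]; exists p; split => //; apply: le_trans pr rr'. Qed.

Lemma reach_refl x r : 0 <= r -> reach x x r.
Proof. by move=> r0; exists [::]; split => //; rewrite /path_time big_nil. Qed.

Lemma reach_trans y x z r r' : reach x y r -> reach y z r' -> reach x z (r + r').
Proof.
move=> [p [xp py pr]] [q [yq qz qr]]; exists (p ++ q); split.
- by rewrite cat_path xp py.
- by rewrite last_cat py.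
- by rewrite path_time_cat py lerD.
Qed.

Lemma reach_edge x y r : adj x y -> w [set x; y]%SET <= r -> reach x y r.
Proof.
by move=> xy wr; exists [:: y]; split; rewrite /= ?xy // path_time_cons /path_time big_nil addr0.
Qed.

End Reach.

(** * Geometry of the grid *)

Section GridGeometry.
Variables (R : realType) (d k : nat).
Local Notation V := (grid_vertex d k).
Implicit Types (x y z : V).

Lemma grid_adj_step x y i : (forall j, j != i -> x j = y j) ->
  ((x i).+1 = y i :> nat \/ (y i).+1 = x i :> nat) -> grid_adj R x y.
Proof.
move=> xy xyi; rewrite /grid_adj /euclidean_dist (bigD1 i) //= big1 ?addr0.
  have -> : ((x i)%:R - (y i)%:R) ^+ 2 = 1 :> R.
    by case: xyi => <-; rewrite -natr1; ring.
  by rewrite sqrtr1.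
by move=> j /xy->; rewrite subrr expr0n.
Qed.

Definition differ x y : {set 'I_d} := [set i | x i != y i].

(** The vertices [visit x y B] are the vertices of the cube with opposite corners
    [x] and [y] when these vertices are neighbouring. *)
Definition visit x y (B : {set 'I_d}) : V := [ffun i => if i \in B then y i else x i].

Definition flip_edge x y B b : {set V} := [set visit x y B; visit x y (b |: B)]%SET.

Definition neighbouring x y :=
  forall i, x i = y i \/ (x i).+1 = y i :> nat \/ (y i).+1 = x i :> nat.

Lemma visit_inj x y (B B' : {set 'I_d}) : B \subset differ x y -> B' \subset differ x y ->
  visit x y B = visit x y B' -> B = B'.
Proof.
move=> /fintype.subsetP BU /fintype.subsetP BU' /ffunP E; apply/setP => i.
have := E i; rewrite !ffunE; case iB: (i \in B); case iB': (i \in B') => //.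
  by move: (BU _ iB); rewrite inE => /eqP xy /esym.
by move: (BU' _ iB'); rewrite inE => /eqP xy.
Qed.

Lemma flip_edge_inj x y (B B' : {set 'I_d}) b b' : B \subset differ x y -> B' \subset differ x y ->
  b \in differ x y :\: B -> b' \in differ x y :\: B' ->
  flip_edge x y B b = flip_edge x y B' b' -> B = B' /\ b = b'.
Proof.
move=> BU BU' bU bU' E.
have sub (C : {set 'I_d}) c : C \subset differ x y -> c \in differ x y :\: C ->
    (c |: C \subset differ x y) /\ #|c |: C| = #|C|.+1.
  rewrite inE => CU /andP[cC cU]; rewrite finset.subUset finset.sub1set cU CU.
  by rewrite cardsU1 cC.
have [bBU cB] := sub _ _ BU bU; have [bBU' cB'] := sub _ _ BU' bU'.
have : visit x y B \in flip_edge x y B' b' by rewrite -E !inE eqxx.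
have : visit x y (b |: B) \in flip_edge x y B' b' by rewrite -E !inE eqxx orbT.
rewrite !inE => /orP[]/eqP/visit_inj H1 /orP[]/eqP/visit_inj H2.
- by have := cB; rewrite H1 // H2 //; lia.
- by have := cB'; rewrite -H2 // -H1 //; lia.
- have BB' := H2 BU BU'; split => //; have /setP/(_ b) := H1 bBU bBU'.
  rewrite !inE eqxx /= -BB'; move: bU; rewrite inE => /andP[/negbTE-> _].
  by rewrite orbF => /esym/eqP.
- by have := cB; rewrite H1 // H2 //; lia.
Qed.

Lemma visitU x y : visit x y (differ x y) = y.
Proof.
by apply/ffunP => i; rewrite ffunE inE; case: eqP => [->|].
Qed.

Lemma visit0 x y : visit x y finset.set0 = x.
Proof. by apply/ffunP => i; rewrite ffunE inE. Qed.

Lemma reach_order (w : {set V} -> R) x y B p : neighbouring x y ->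
  uniq p -> {subset p <= differ x y :\: B} ->
  reach (@grid_adj R d k) w (visit x y B) (visit x y (B :|: [set i in p]))
    (\sum_(e <- order_edges (flip_edge x y) B p) w e).
Proof.
move=> nxy; elim: p B => [|b p IH] B /=.
  move=> _ _; rewrite big_nil; have -> : B :|: [set i in [::]] = B.
    by apply/setP => i; rewrite !inE orbF.
  exact: reach_refl.
move=> /andP[bp up] sp; rewrite big_cons.
have bUB : b \in differ x y :\: B by apply: sp; rewrite mem_head.
apply: (reach_trans (y := visit x y (b |: B))).
  apply: reach_edge => //; apply: (@grid_adj_step _ _ b) => [j jb|].
    by rewrite !ffunE !inE (negbTE jb).
  move: bUB; rewrite !ffunE !inE eqxx /= => /andP[/negbTE-> xyb].
  by case: (nxy b) => [E|//]; rewrite E eqxx in xyb.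
have -> : B :|: [set i in b :: p] = b |: B :|: [set i in p].
  by apply/setP => i; rewrite !inE orbCA orbA.
by apply: IH => //; apply: subset_setDU1.
Qed.

(** Every coordinate moves by one unit per step from [x] towards [y], and stays
    there once it has arrived. *)
Definition diag x y (j : nat) : V :=
  [ffun i => inord (if (x i <= y i)%N then minn (x i + j) (y i) else maxn (x i - j) (y i))].

Lemma diagE x y j i : diag x y j i =
  (if (x i <= y i)%N then minn (x i + j) (y i) else maxn (x i - j) (y i)) :> nat.
Proof.
rewrite ffunE inordK //; have := ltn_ord (x i); have := ltn_ord (y i).
case: ifP; lia.
Qed.

Lemma diag0 x y : diag x y 0 = x.
Proof. by apply/ffunP => i; apply: ord_inj; rewrite diagE; case: ifP; lia. Qed.

Lemma diagk x y : diag x y k = y.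
Proof.
apply/ffunP => i; apply: ord_inj; rewrite diagE.
by have := ltn_ord (x i); have := ltn_ord (y i); case: ifP; lia.
Qed.

Lemma diag_fixed x y j i : x i = y i -> diag x y j i = x i.
Proof. by move=> E; apply: val_inj; rewrite /= diagE E leqnn; lia. Qed.

Lemma neighbouring_diag x y j : neighbouring (diag x y j) (diag x y j.+1).
Proof.
move=> i; have : diag x y j i = diag x y j.+1 i :> nat \/
  (diag x y j i).+1 = diag x y j.+1 i :> nat \/
  (diag x y j.+1 i).+1 = diag x y j i :> nat.
  by rewrite !diagE; case: ifP; lia.
by case=> [/val_inj|]; [left|right].
Qed.

Definition shift x (i : 'I_d) (j : 'I_k.+1) : V := [ffun i' => if i' == i then j else x i'].

Definition line_edge x i (j : nat) : {set V} :=
  [set shift x i (inord j); shift x i (inord j.+1)]%SET.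

Lemma shift_id x i : shift x i (x i) = x.
Proof. by apply/ffunP => i'; rewrite ffunE; case: eqP => [->|]. Qed.

Lemma line_edge_inj x i j j' : (j < k)%N -> (j' < k)%N ->
  line_edge x i j = line_edge x i j' -> j = j'.
Proof.
have vals m l : (m < k)%N -> (l < k)%N -> line_edge x i m = line_edge x i l -> (l <= m)%N.
  move=> mk lk E.
  have : shift x i (inord m) \in line_edge x i l by rewrite -E !inE eqxx.
  rewrite !inE => /orP[]/eqP/ffunP/(_ i); rewrite !ffunE eqxx => /(congr1 val);
    rewrite /= !inordK //; lia.
move=> jk jk' E; apply/eqP; rewrite eqn_leq.
by rewrite (vals j' j) // (vals j j').
Qed.

Section Line.
Variable w : {set V} -> R.
Hypothesis w_ge0 : forall a, 0 <= w a.

Let adj_line x i j : (j < k)%N -> grid_adj R (shift x i (inord j)) (shift x i (inord j.+1))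
  /\ grid_adj R (shift x i (inord j.+1)) (shift x i (inord j)).
Proof.
move=> jk; split; apply: (@grid_adj_step _ _ i) => [i' /negbTE i'i|];
  rewrite !ffunE ?i'i // eqxx !inordK; lia.
Qed.

Lemma reach_line_seg x i a n : (a + n <= k)%N ->
  reach (@grid_adj R d k) w (shift x i (inord a)) (shift x i (inord (a + n)))
    (\sum_(a <= j < a + n) w (line_edge x i j)) /\
  reach (@grid_adj R d k) w (shift x i (inord (a + n))) (shift x i (inord a))
    (\sum_(a <= j < a + n) w (line_edge x i j)).
Proof.
elim: n => [|n IH] ank; first by rewrite addn0 big_geq //; split; apply: reach_refl.
rewrite addnS big_nat_recr ?leq_addr //=.
have ank' : (a + n < k)%N by lia.
have [IH1 IH2] := IH (ltnW ank'); have [step1 step2] := adj_line x i ank'; split.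
  by apply: reach_trans IH1 _; apply: reach_edge.
rewrite addrC; apply: reach_trans IH2; apply: reach_edge => //.
by rewrite finset.setUC.
Qed.

Lemma reach_line x i (j : 'I_k.+1) :
  reach (@grid_adj R d k) w x (shift x i j) (\sum_(m < k) w (line_edge x i m)) /\
  reach (@grid_adj R d k) w (shift x i j) x (\sum_(m < k) w (line_edge x i m)).
Proof.
have seg (a b : 'I_k.+1) : (a <= b)%N ->
    reach (@grid_adj R d k) w (shift x i a) (shift x i b)
      (\sum_(m < k) w (line_edge x i m)) /\
    reach (@grid_adj R d k) w (shift x i b) (shift x i a)
      (\sum_(m < k) w (line_edge x i m)).
  move=> ab; have bk : (a + (b - a) <= k)%N by rewrite subnKC // -ltnS.
  have [] := reach_line_seg x i bk; rewrite subnKC // !inord_val => r1 r2.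
  have le : \sum_(a <= j < b) w (line_edge x i j) <= \sum_(m < k) w (line_edge x i m).
    rewrite -(big_mkord xpredT (fun m => w (line_edge x i m))).
    have b_le : (b <= k)%N by rewrite -ltnS.
    rewrite (big_cat_nat (leq0n b) b_le) (big_cat_nat (leq0n a) ab) /=.
    by rewrite addrAC lerDr addr_ge0 // sumr_ge0.
  by split; [apply: reach_le r1 | apply: reach_le r2].
by case: (leqP (x i) j) => [/seg|/ltnW/seg]; rewrite shift_id => -[].
Qed.

End Line.
End GridGeometry.

(** * Passage times of the grid for rounded weights *)

Section ThresholdCount.
Variable R : realType.

(** For [0 < r <= n] this is the ceiling of [r]; the form of a sum of indicators
    reduces its exponential moment to tail probabilities. *)
Definition thresholds_below (r : R) n : nat := (\sum_(m < n) (m%:R < r)%R)%N.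

Lemma thresholds_below_ge (r : R) n : r <= n%:R -> r <= (thresholds_below r n)%:R.
Proof.
elim: n => [|n IH]; first by rewrite /thresholds_below big_ord0.
rewrite /thresholds_below big_ord_recr /= -/(thresholds_below r n) => rn; case: ltP => [nr|/IH]; last first.
  by move=> rc; apply: le_trans rc _; rewrite ler_nat leq_addr.
suff -> : thresholds_below r n = n by rewrite addn1.
rewrite /thresholds_below (eq_bigr (fun=> 1%N)) ?sum_nat_const ?card_ord ?muln1 // => m _.
by rewrite (lt_trans _ nr) // ltr_nat.
Qed.

Lemma thresholds_below_le (r : R) n : (thresholds_below r n <= n)%N.
Proof.
rewrite -[leqRHS]muln1 -[n in leqRHS]card_ord -sum_nat_const.
by apply: leq_sum => m _; apply: leq_b1.
Qed.

Lemma pow_thresholds_below_le (r : R) n :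
  (3 / 2) ^+ thresholds_below r n <= 1 + 2^-1 * \sum_(m < n) (3 / 2) ^+ m * (m%:R < r)%R%:R :> R.
Proof.
elim: n => [|n IH]; first by rewrite /thresholds_below !big_ord0 mulr0 addr0 expr0.
rewrite /thresholds_below !big_ord_recr /= -/(thresholds_below r n); case: ltP => _; last first.
  by rewrite addn0 mulr0 addr0.
rewrite addn1 exprS mulrDr addrA mulr1.
have : (3 / 2) ^+ thresholds_below r n <= (3 / 2) ^+ n :> R.
  by rewrite ler_weXn2l ?thresholds_below_le //; lra.
lra.
Qed.

End ThresholdCount.

Section GridProbability.
Variables (R : realType) (d k : nat).
Local Notation V := (grid_vertex d k).
Local Notation adj := (@grid_adj R d k).
Implicit Types (x y z : V).

(** Weights with finitely many values, dominated by exponential variables of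
    mean 1.  The law depends on the edge, so that a set of vertices which is not
    an edge can carry the weight 0. *)
Variables (S : finType) (mu : {set V} -> S -> R) (W : S -> R) (M : nat).
Hypotheses (mu_ge0 : forall a s, 0 <= mu a s) (mu_sum : forall a, \sum_s mu a s = 1).
Hypotheses (W_ge0 : forall s, 0 <= W s) (W_le : forall s, W s <= M%:R).
Hypothesis tail : forall a (t : R), 0 <= t -> \sum_(s | t < W s) mu a s <= expR (- t).

Local Notation weights s := (fun a : {set V} => W (s a)).

Definition crossing x y : {ffun {set V} -> S} -> R :=
  crossing_time (differ x y) (flip_edge x y) W (M * d).

Let W_le_crossing x y s : W s * #|differ x y|%:R <= (M * d)%:R * 96.
Proof.
have dd : (#|differ x y| <= d)%N by rewrite -[leqRHS]card_ord max_card.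
rewrite natrM; have := W_le s; have := W_ge0 s => W0 WM.
apply: (@le_trans _ _ (M%:R * d%:R)).
  by apply: ler_pM => //; rewrite ler_nat.
by rewrite ler_peMr ?mulr_ge0 // ler1n.
Qed.

Lemma expect_crossing x y : expect mu (crossing x y) <= 384.
Proof.
exact: (expect_crossing_time (@flip_edge_inj d k x y) mu_ge0 mu_sum _ tail).
Qed.

Lemma crossing_ge0 x y s : 0 <= crossing x y s.
Proof. exact: crossing_time_ge0. Qed.

Lemma reach_crossing x y (s : {ffun {set V} -> S}) :
  neighbouring x y -> reach adj (weights s) x y (crossing x y s).
Proof.
move=> nxy.
have [p pp pW] := crossing_timeP (@flip_edge_inj d k x y) (W_le_crossing x y) s.
have [sp up subp _] := paths_props (@flip_edge_inj d k x y) pp.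
apply: reach_le pW _.
have := @reach_order R d k (weights s) x y finset.set0 p nxy up.
rewrite visit0; have -> : finset.set0 :|: [set i in p] = differ x y.
  apply/eqP; rewrite finset.set0U eqEcard; apply/andP; split.
    by apply/fintype.subsetP => i; rewrite inE => /subp.
  rewrite -sp -(card_uniqP up); apply: eq_leq.
  by apply: eq_card => i; rewrite inE.
by rewrite visitU; apply => i /subp; rewrite finset.setD0.
Qed.

(** The edges inside the flat through [x] spanned by the directions in which [x]
    and [y] differ.  The empty set, which is not an edge, is excluded because it
    would lie in every flat. *)
Definition in_flat x y (a : {set V}) : bool :=
  (a != finset.set0) && [forall u in a, [forall i, (x i == y i) ==> (u i == x i)]].

Lemma in_flatP x y (a : {set V}) : reflect
  ((exists u, u \in a) /\ forall u, u \in a -> forall i, x i = y i -> u i = x i)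
  (in_flat x y a).
Proof.
apply: (iffP andP) => [[/set0Pn a0 /forall_inP H]|[a0 H]]; split => //.
- by move=> u /H/forallP Hu i /eqP xy; apply/eqP; have := Hu i; rewrite xy.
- exact/set0Pn.
apply/forall_inP => u ua; apply/forallP => i; apply/implyP => /eqP xy.
by apply/eqP/H.
Qed.

Lemma crossing_depends x y : depends_on (in_flat x y) (crossing x y).
Proof.
apply: crossing_time_depends => p e /mem_orders[sp up sub] ep.
have [j [b [jp -> bU _]]] := order_edgesP ep up sub.
apply/in_flatP; split; first by exists (visit x y (finset.set0 :|: [set i in take j p])); rewrite !inE eqxx.
by move=> u; rewrite !inE => /orP[]/eqP-> i xy; rewrite ffunE -xy; case: ifP.
Qed.

Definition travel x y (s : {ffun {set V} -> S}) : R :=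
  \sum_(j < k) crossing (diag x y j) (diag x y j.+1) s.

Lemma travel_ge0 x y s : 0 <= travel x y s.
Proof. by apply: sumr_ge0 => j _; apply: crossing_ge0. Qed.

Lemma expect_travel x y : expect mu (travel x y) <= 384 * k%:R.
Proof.
rewrite expect_sum; apply: (@le_trans _ _ (\sum_(j < k) 384)).
  by apply: ler_sum => j _; apply: expect_crossing.
by rewrite sumr_const card_ord -[_ *+ k]mulr_natr.
Qed.

Lemma reach_travel x y (s : {ffun {set V} -> S}) : reach adj (weights s) x y (travel x y s).
Proof.
suff H n : (n <= k)%N -> reach adj (weights s) x (diag x y n)
    (\sum_(0 <= j < n) crossing (diag x y j) (diag x y j.+1) s).
  by have := H k (leqnn k); rewrite diagk big_mkord.
elim: n => [|n IH] nk; first by rewrite big_geq // diag0; apply: reach_refl.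
rewrite big_nat_recr //=; apply: reach_trans (IH (ltnW nk)) _.
by apply: reach_crossing; apply: neighbouring_diag.
Qed.

Lemma travel_depends x y : depends_on (in_flat x y) (travel x y).
Proof.
move=> s t st; apply: eq_bigr => j _; apply: crossing_depends => a /in_flatP[a0 au].
apply: st; apply/in_flatP; split => // u ua i xy.
by have := au u ua i; rewrite !diag_fixed //; apply.
Qed.

Lemma travel_markov x y c : (0 < c)%N -> (0 < k)%N ->
  prob mu (fun s => (c * k)%:R < travel x y s) <= 384 / c%:R.
Proof.
move=> c0 k0; have ck0 : 0 < (c * k)%:R :> R by rewrite ltr0n muln_gt0 c0.
apply: le_trans (markov_expect mu_ge0 ck0 (@travel_ge0 x y)) _.
rewrite ler_pdivrMr //; apply: le_trans (expect_travel x y) _.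
by rewrite natrM mulrA divfK // pnatr_eq0 -lt0n.
Qed.

Definition line_time x i (s : {ffun {set V} -> S}) : R := \sum_(m < k) W (s (line_edge x i m)).

Let expect_pow_thresholds_below a : \sum_s mu a s * (3 / 2) ^+ thresholds_below (W s) M <= 3.
Proof.
apply: (@le_trans _ _ (\sum_s mu a s * (1 + 2^-1 * \sum_(m < M) (3 / 2) ^+ m * (m%:R < W s)%R%:R))).
  by apply: ler_sum => s _; apply: ler_wpM2l => //; apply: pow_thresholds_below_le.
under eq_bigr do rewrite mulrDr mulr1.
rewrite big_split /= mu_sum.
have -> : \sum_s mu a s * (2^-1 * \sum_(m < M) (3 / 2) ^+ m * (m%:R < W s)%R%:R) =
   2^-1 * \sum_(m < M) (3 / 2) ^+ m * \sum_(s | m%:R < W s) mu a s.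
  under eq_bigr do rewrite mulrCA mulr_sumr.
  rewrite -mulr_sumr exchange_big; congr (_ * _); apply: eq_bigr => m _ /=.
  rewrite mulr_sumr [RHS]big_mkcond; apply: eq_bigr => s _.
  by case: ltP => _; rewrite ?mulr0 // mulr1 mulrC.
have : \sum_(m < M) (3 / 2) ^+ m * \sum_(s | m%:R < W s) mu a s <= \sum_(m < M) (3 / 4) ^+ m.
  apply: ler_sum => m _.
  have -> : 3 / 4 = 3 / 2 * 2^-1 :> R by lra.
  rewrite [leRHS]exprMn; apply: ler_wpM2l; first by rewrite exprn_ge0 ?divr_ge0.
  apply: le_trans (tail _ (ler0n _ m)) _.
  rewrite expRN -[m%:R]mulr1 expRM_natl -exprVn; apply: lerXn2r; rewrite ?nnegrE ?invr_ge0 ?expR_ge0 //.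
  by rewrite lef_pV2 ?posrE ?expR_gt0 //; have := expR_ge1Dx (1 : R); lra.
have z1 : (0 <= 3 / 4 :> R) && (3 / 4 < 1 :> R) by apply/andP; split; lra.
have := sum_geometric_le M z1.
have -> : 1 - 3 / 4 = 4^-1 :> R by lra.
rewrite invrK; lra.
Qed.

(** Exponential Markov inequality: the variable [(3 / 2) ^+ G], where [G] is a
    weight rounded up, has mean at most 3, and [(3 / 2) ^+ c >= c / 2].  This
    gives 6 in place of 384, which is there to match [travel_markov]. *)
Lemma line_tail x i c : (0 < c)%N ->
  prob mu (fun s => (c * k)%:R < line_time x i s) <= (384 / c%:R) ^+ k.
Proof.
move=> c0; have c0' : 0 < c%:R :> R by rewrite ltr0n.
pose f s : R := (3 / 2) ^+ thresholds_below (W s) M.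
have f_ge0 s : 0 <= f s by rewrite exprn_ge0 ?divr_ge0.
pose z : R := (3 / 2) ^+ (c * k).
have z0 : 0 < z by rewrite exprn_gt0 ?divr_gt0.
apply: (@le_trans _ _ (z^-1 * expect mu (fun s => \prod_(m < k) f (s (line_edge x i m))))).
  rewrite -expectZ; apply: ler_expect => // s.
  case: ltP => [lt|_]; last by rewrite mulr_ge0 ?invr_ge0 ?(ltW z0) // prodr_ge0.
  rewrite mulrC ler_pdivlMr // mul1r.
  have -> : \prod_(m < k) f (s (line_edge x i m)) =
     (3 / 2) ^+ (\sum_(m < k) thresholds_below (W (s (line_edge x i m))) M)%N.
    by apply: esym; apply: (big_morph _ (exprD _) (expr0 _)).
  apply: ler_weXn2l; first by lra.
  rewrite -(ler_nat R); apply: le_trans (ltW lt) _; rewrite natr_sum.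
  by apply: ler_sum => m _; apply: thresholds_below_ge.
rewrite (@expect_indep_seq _ _ _ _ mu_sum _ (index_enum 'I_k) (fun m => pred1 (line_edge x i m))).
- have pow3 : \prod_(m < k) expect mu (fun s => f (s (line_edge x i m))) <= 3 ^+ k.
    rewrite -[k in leRHS]card_ord -prodr_const; apply: ler_prod => m _.
    by rewrite expect_ge0 //= expect_coord // expect_pow_thresholds_below.
  apply: (@le_trans _ _ (z^-1 * 3 ^+ k)).
    by apply: ler_wpM2l => //; rewrite invr_ge0 ltW.
  rewrite /z exprM -exprVn -exprMn; apply: lerXn2r;
    rewrite ?nnegrE ?mulr_ge0 ?invr_ge0 ?exprn_ge0 ?divr_ge0 ?ler0n //.
  rewrite mulrC ler_pdivrMr ?exprn_gt0 ?divr_gt0 // mulrAC ler_pdivlMr //.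
  have h0 : 0 <= 2^-1 :> R by rewrite invr_ge0.
  have := bernoulli_ineq c h0; have -> : 1 + 2^-1 = 3 / 2 :> R by lra.
  lra.
- exact: index_enum_uniq.
- by move=> m _ s t st; rewrite st //=.
- move=> m m' a _ _ /eqP-> /eqP /line_edge_inj E; apply: val_inj; exact: E.
Qed.

(** No fast detour from [x] to [y] through a hyperplane orthogonal to direction
    [i].  The lines through [x] and [y] have to be fast as a whole, so that this
    requirement is the same for all the values [j] that can be tried. *)
Definition detour_fails c x y i (s : {ffun {set V} -> S}) : bool :=
  [|| (c * k)%:R < line_time x i s, (c * k)%:R < line_time y i s |
      all (fun j => (c * k)%:R < travel (shift x i j) (shift y i j) s)
        [seq j <- enum 'I_k.+1 | j != x i]].

Lemma reach_detour c x y i (s : {ffun {set V} -> S}) : ~~ detour_fails c x y i s ->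
  reach adj (weights s) x y (3 * (c * k)%:R).
Proof.
rewrite !negb_or -!leNgt => /and3P[lx ly]; rewrite -has_predC => /hasP[j _] /=.
rewrite -leNgt => tj.
have w0 a : 0 <= W (s a) by [].
have -> : 3 * (c * k)%:R = (c * k)%:R + (c * k)%:R + (c * k)%:R :> R by lra.
apply: (reach_trans (y := shift y i j)); last first.
  by apply: reach_le ly _; have [] := reach_line w0 y i j.
apply: (reach_trans (y := shift x i j)); last first.
  by apply: reach_le tj _; apply: reach_travel.
by apply: reach_le lx _; have [] := reach_line w0 x i j.
Qed.

(** The travels take place in distinct hyperplanes orthogonal to direction [i],
    so that they are independent. *)
Lemma prob_travels x y i c : (0 < c)%N -> (0 < k)%N -> x i = y i ->
  prob mu (fun s => all (fun j => (c * k)%:R < travel (shift x i j) (shift y i j) s)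
     [seq j <- enum 'I_k.+1 | j != x i]) <= (384 / c%:R) ^+ k.
Proof.
move=> c0 k0 xyi.
pose layer (j : 'I_k.+1) : pred {set V} :=
  fun a => (a != finset.set0) && [forall u in a, u i == j].
rewrite (prob_indep_seq mu_sum (A := layer)).
- have sz : size [seq j <- enum 'I_k.+1 | j != x i] = k.
    rewrite -[RHS]/(k.+1.-1) -[in RHS](card_ord k.+1) -(cardC1 (x i)) cardE.
    apply/perm_size/uniq_perm => [||j]; last by rewrite mem_filter !mem_enum !inE andbT.
      exact/filter_uniq/enum_uniq.
    exact: enum_uniq.
  rewrite -[in leRHS]sz; apply: prodr_seq_le => j _.
  by rewrite prob_ge0 //= travel_markov.
- by rewrite filter_uniq // enum_uniq.
- move=> j _ s t st; rewrite (@travel_depends _ _ s t) // => a /in_flatP[a0 au].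
  apply: st; apply/andP; split; first exact/set0Pn.
  apply/forall_inP => u /au/(_ i); rewrite !ffunE eqxx => /(_ erefl)->.
  by [].
move=> j j' a _ _ /andP[/set0Pn[u ua] /forall_inP H] /andP[_ /forall_inP H'].
by have /eqP <- := H u ua; have /eqP <- := H' u ua.
Qed.

Lemma prob_detour_fails x y i c : (0 < c)%N -> (0 < k)%N -> x i = y i ->
  prob mu (detour_fails c x y i) <= 3 * (384 / c%:R) ^+ k.
Proof.
move=> c0 k0 xyi; apply: le_trans (probU mu_ge0 _ _) _.
apply: le_trans (lerD (line_tail x i c0) (probU mu_ge0 _ _)) _.
have := line_tail y i c0; have := prob_travels c0 k0 xyi.
lra.
Qed.

Section AgreeingPoints.
Variables (H : {set 'I_d}) (x y : V).
Hypothesis xyH : forall i, i \in H -> x i = y i.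

(** A set of edges containing all those used by the detours in direction [i].
    These sets are disjoint: an edge of the set of [i] leaves the hyperplane of
    value [x i], in which the edges of the other sets are contained. *)
Let private i : pred {set V} := fun a =>
  `[< (exists u, u \in a /\ u i != x i) /\
      forall u, u \in a -> forall i', i' \in H -> i' != i -> u i' = x i' >].

Let line_depends z i : i \in H -> (forall i', i' \in H -> z i' = x i') ->
  depends_on (private i) (line_time z i).
Proof.
move=> iH zx s t st; apply: eq_bigr => m _; rewrite st //; apply/asboolP; split.
  have mk := ltn_ord m.
  have [E|ne] := eqVneq (shift z i (inord m) i) (x i); last first.
    by exists (shift z i (inord m)); rewrite !inE eqxx.
  exists (shift z i (inord m.+1)); rewrite !inE eqxx orbT; split => //.
  rewrite -E !ffunE eqxx; apply/eqP => /(congr1 val) /=.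
  by rewrite !inordK; lia.
move=> u; rewrite !inE => /orP[]/eqP-> i' i'H /negbTE i'i; by rewrite ffunE i'i zx.
Qed.

Let detour_depends c i : i \in H -> depends_on (private i) (detour_fails c x y i).
Proof.
move=> iH s t st; rewrite /detour_fails.
rewrite (line_depends iH _ st) // (@line_depends y i iH _ s t st) => [|i' /xyH //].
congr [|| _, _ | _]; apply: eq_in_all => j; rewrite mem_filter => /andP[jx _].
rewrite (@travel_depends _ _ s t) // => a /in_flatP[[u ua] au].
apply: st; apply/asboolP; split.
  exists u; split => //; have := au u ua i; rewrite !ffunE eqxx => ->//.
move=> v va i' i'H /negbTE i'i; have := au v va i'; rewrite !ffunE i'i.
by apply; apply: xyH.
Qed.

Lemma prob_no_reach_agreeing c : (0 < c)%N -> (0 < k)%N ->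
  prob mu (fun s => ~~ `[< reach adj (weights s) x y (3 * (c * k)%:R) >]) <=
    (3 * (384 / c%:R) ^+ k) ^+ #|H|.
Proof.
move=> c0 k0.
apply: (@le_trans _ _ (prob mu (fun s => all (fun i => detour_fails c x y i s) (enum H)))).
  apply: ler_prob => // s /asboolPn nr; apply/allP => i _.
  by apply/negPn/negP => /reach_detour.
rewrite (prob_indep_seq mu_sum (A := private)).
- rewrite cardE; apply: prodr_seq_le => i; rewrite mem_enum => iH.
  by rewrite prob_ge0 //= prob_detour_fails // xyH.
- exact: enum_uniq.
- by move=> i; rewrite mem_enum => /detour_depends; apply.
move=> i i'  a; rewrite !mem_enum => iH i'H /asboolP[[u [ua ui]] _] /asboolP[_ H2].
apply/eqP/negPn/negP => ii'; have := H2 u ua i iH ii'; move/eqP: ui.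
by [].
Qed.

End AgreeingPoints.

(** The intermediate vertex agrees with [x] on one half [H] of the coordinates
    and with [y] on the other half; the detours of the two parts of the walk use
    the directions of [H] and of its complement.  Each half has at least a third
    of the directions, except in dimension 1, where a line is used. *)
Lemma prob_no_reach x y c : (0 < d)%N -> (0 < k)%N -> (0 < c)%N ->
  384 / c%:R = 3^-1 * 8^-1 ^+ 3 :> R ->
  prob mu (fun s => ~~ `[< reach adj (weights s) x y (6 * (c * k)%:R) >]) <=
    2 * 8^-1 ^+ (k * d).
Proof.
move=> d0 k0 c0 cE.
have small : 3 * (384 / c%:R) ^+ k <= 8^-1 ^+ (3 * k) :> R.
  rewrite cE exprMn -exprM mulrA; apply: ler_piMl; first by rewrite exprn_ge0 ?invr_ge0.
  by rewrite exprVn ler_pdivrMr ?exprn_gt0 // mul1r ler_eXnr // ler1n.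
have half (H : {set 'I_d}) : (d <= 3 * #|H|)%N ->
    (3 * (384 / c%:R) ^+ k) ^+ #|H| <= 8^-1 ^+ (k * d) :> R.
  move=> dH; apply: (@le_trans _ _ ((8^-1 ^+ (3 * k)) ^+ #|H|)).
    apply: lerXn2r; rewrite ?nnegrE ?mulr_ge0 ?exprn_ge0 ?divr_ge0 ?invr_ge0 ?ler0n //.
  rewrite -exprM; apply: ler_wiXn2l; rewrite ?invr_ge0 ?invf_le1 ?ler1n //.
  by rewrite -mulnA mulnCA leq_mul2l dH orbT.
have [d1|d2] := leqP d 1.
  have {d0 d1} d1 : d = 1%N by lia.
  have i0 : 'I_d by rewrite d1; exact: ord0.
  have iE (i : 'I_d) : i = i0.
    by apply: ord_inj; have := ltn_ord i; have := ltn_ord i0; rewrite {2 4}d1; lia.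
  have yE : y = shift x i0 (y i0).
    by apply/ffunP => i; rewrite ffunE (iE i) eqxx.
  apply: (@le_trans _ _ (prob mu (fun s => (c * k)%:R < line_time x i0 s))).
    apply: ler_prob => // s /asboolPn nr; rewrite ltNge; apply/negP => l.
    apply: nr; rewrite yE; apply: reach_le (_ : line_time x i0 s <= _) _.
      by have := ler0n R (c * k); lra.
    by have [] := reach_line (fun a => W_ge0 (s a)) x i0 (y i0).
  apply: le_trans (line_tail x i0 c0) _; rewrite d1 muln1.
  have e0 : 0 <= (384 / c%:R) ^+ k :> R by rewrite exprn_ge0 ?divr_ge0 ?ler0n.
  have : 8^-1 ^+ (3 * k) <= 8^-1 ^+ k :> R.
    by apply: ler_wiXn2l; rewrite ?invr_ge0 ?invf_le1 ?ler1n // leq_pmull.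
  have : 0 <= 8^-1 ^+ k :> R by rewrite exprn_ge0 ?invr_ge0.
  lra.
pose H : {set 'I_d} := [set i : 'I_d | (i < d./2)%N].
have cH : #|H| = d./2.
  rewrite cardsE -sum1_card.
  have hd : (d./2 <= d)%N by lia.
  rewrite -[RHS](card_ord d./2) -[RHS]sum1_card (big_ord_widen _ (fun=> 1%N) hd).
  by apply: eq_bigl => i; rewrite unfold_in.
have cHC : #|~: H| = (d - d./2)%N by rewrite cardsCs finset.setCK card_ord cH.
pose u : V := [ffun i => if i \in H then x i else y i].
have xu i : i \in H -> x i = u i by move=> iH; rewrite ffunE iH.
have uy i : i \in ~: H -> u i = y i by rewrite inE ffunE => /negbTE->.
apply: (@le_trans _ _ (prob mu (fun s =>
   (~~ `[< reach adj (weights s) x u (3 * (c * k)%:R) >]) ||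
   (~~ `[< reach adj (weights s) u y (3 * (c * k)%:R) >])))).
  apply: ler_prob => // s; rewrite -negb_and; apply: contra.
  move=> /andP[/asboolP r1 /asboolP r2]; apply/asboolP.
  by apply: reach_le (reach_trans r1 r2); lra.
apply: le_trans (probU mu_ge0 _ _) _.
have -> : 2 * 8^-1 ^+ (k * d) = 8^-1 ^+ (k * d) + 8^-1 ^+ (k * d) :> R by lra.
apply: lerD.
  by apply: le_trans (prob_no_reach_agreeing xu c0 k0) (half _ _); rewrite cH; lia.
by apply: le_trans (prob_no_reach_agreeing uy c0 k0) (half _ _); rewrite cHC; lia.
Qed.

End GridProbability.

(** * Comparison of rounded and original weights *)

Section SimplePaths.
Variables (R : realType) (V : finType) (adj : rel V).
Implicit Types (w : {set V} -> R).

Lemma reach_simple w x y r : (forall a, 0 <= w a) -> reach adj w x y r ->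
  exists p, [/\ is_st_path adj x y p & path_time w x p <= r].
Proof.
move=> w0 [p [xp py pr]].
suff [q [xq qy uq qp]] : exists q, [/\ path adj x q, last x q = last x p,
    uniq (x :: q) & path_time w x q <= path_time w x p].
  exists q; split; last exact: le_trans qp pr.
  by rewrite /is_st_path xq uq qy py eqxx.
elim: p x xp {py pr} => [|z p IH] x; first by move=> _; exists [::].
move=> /andP[xz zp]; have [q [zq qz uq qp]] := IH z zp.
have [xq|xq] := boolP (x \in z :: q); last first.
  exists (z :: q); split; rewrite /= ?xz //; first by rewrite xq.
  by rewrite !path_time_cons lerD2l.
rewrite path_time_cons /=; move: xq; rewrite inE => /predU1P[->|xq].
  by exists q; split => //; apply: le_trans qp _; rewrite lerDr.
case/path.splitPr: xq zq qz uq qp => q1 q2; rewrite -cat_rcons => zq qz uq qp.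
exists q2; split.
- by move: zq; rewrite cat_path last_rcons => /andP[].
- by move: qz; rewrite last_cat last_rcons.
- by move: uq; rewrite cat_rcons cons_uniq cat_uniq => /and4P[].
- move: qp; rewrite path_time_cat last_rcons => qp.
  have : 0 <= path_time w z (rcons q1 x) by apply: sumr_ge0.
  by have := w0 [set x; z]%SET; lra.
Qed.

Lemma path_time_le w w' delta x p : path adj x p ->
  (forall a, a \in edges adj -> w a <= w' a + delta) ->
  path_time w x p <= path_time w' x p + (size p)%:R * delta.
Proof.
move=> xp ww'; elim: p x xp => [|y p IH] x /=.
  by rewrite /path_time !big_nil mul0r addr0.
move=> /andP[xy yp]; rewrite !path_time_cons -natr1 mulrDl mul1r.
have : [set x; y]%SET \in edges adj.
  by rewrite inE; apply/existsP; exists x; apply/existsP; exists y; rewrite xy eqxx.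
by move=> /ww'; have := IH y yp; lra.
Qed.

Lemma fpp_time_le w w' delta x y r : (forall a, 0 <= w' a) -> 0 <= delta ->
  (forall a, a \in edges adj -> w a <= w' a + delta) ->
  reach adj w' x y r ->
  (fpp_time adj w x y <= (r + #|V|%:R * delta)%:E)%E.
Proof.
move=> w0 d0 ww' /(reach_simple w0)[p [xyp pr]].
have /and3P[xp up _] := xyp.
have szp : (size p <= #|V|)%N.
  by rewrite ltnW // -[(size p).+1]/(size (x :: p)) -(card_uniqP up) max_card.
rewrite /fpp_time.
apply: le_trans (@bigmin_le_cond _ _ _ _ (Bseq szp) _ _ _) _ => //=.
rewrite lee_fin; apply: le_trans (path_time_le xp ww') _.
by apply: lerD => //; apply: ler_wpM2r => //; rewrite ler_nat.
Qed.

Lemma fpp_cover_time_le w x r :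
  (forall y, fpp_time adj w x y <= r)%E -> (fpp_cover_time adj w x <= r)%E.
Proof. by move=> H; apply: bigmax_le => //; rewrite leNye. Qed.

End SimplePaths.

(** * The joint law of the rounded weights *)

Local Open Scope classical_set_scope.
Local Open Scope ring_scope.
Section FiniteValued.
Variables (R : realType) (dT : measure_display) (T : measurableType dT).
Variables (P : probability T R) (F : finType) (X : T -> F).
Hypothesis mX : forall f, measurable [set om | X om = f].

Let in_cons_event f (l : seq F) : [set om | X om \in f :: l] =
  [set om | X om = f] `|` [set om | X om \in l].
Proof.
apply/seteqP; split => om /=; rewrite inE; first by move=> /predU1P.
by case=> [->|->]; rewrite ?eqxx ?orbT.
Qed.

Let in_nil_event : [set om | X om \in [::]] = set0.
Proof. by apply/seteqP; split. Qed.

Let measurable_seq_event (l : seq F) : measurable [set om | X om \in l].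
Proof.
elim: l => [|f l ml]; first by rewrite in_nil_event.
by rewrite in_cons_event; apply: measurableU.
Qed.

Let prob_seq_event (l : seq F) : uniq l ->
  P [set om | X om \in l] = (\sum_(f <- l) fine (P [set om | X om = f]))%:E.
Proof.
elim: l => [|f l IH] /=; first by rewrite in_nil_event measure0 big_nil.
move=> /andP[fl /IH Pl]; rewrite in_cons_event measureU //; last first.
  by apply/seteqP; split => om //= -[->]; rewrite (negbTE fl).
rewrite big_cons EFinD; congr (_ + _)%E; last exact: Pl.
by rewrite fineK // fin_num_measure.
Qed.

Let finite_eventE (A : pred F) :
  [set om | A (X om)] = [set om | X om \in [seq f <- enum F | A f]].
Proof.
by apply/seteqP; split => om /=; rewrite mem_filter mem_enum andbT.
Qed.

Lemma measurable_finite_event (A : pred F) : measurable [set om | A (X om)].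
Proof.
by rewrite finite_eventE; apply: measurable_seq_event.
Qed.

Lemma prob_finite_event (A : pred F) :
  P [set om | A (X om)] = (\sum_(f | A f) fine (P [set om | X om = f]))%:E.
Proof.
have uA : uniq [seq f <- enum F | A f] by apply/filter_uniq/enum_uniq.
by rewrite finite_eventE (prob_seq_event uA) big_filter big_enum_cond.
Qed.

End FiniteValued.

Section Discretization.
Variables (R : realType) (dT : measure_display) (T : measurableType dT).
Variables (P : probability T R) (V : finType) (adj : rel V).
Variable tau : {set V} -> {RV P >-> R}.
Hypothesis weights_tau : fpp_weights adj tau.
Variables (N M : nat).
Hypothesis N_gt0 : (0 < N)%N.

Definition level (r : R) : 'I_M.+1 := inord (minn M (Num.truncn (N%:R * r))).

Definition level_value (i : 'I_M.+1) : R := i%:R / N%:R.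

(** The variables attached to sets which are not edges need not be independent of
    the others, so that they are replaced by a constant. *)
Definition edge_level (om : T) (a : {set V}) : 'I_M.+1 :=
  if a \in edges adj then level (tau a om) else ord0.

Definition levels (om : T) : {ffun {set V} -> 'I_M.+1} :=
  [ffun a => edge_level om a].

Definition level_law (a : {set V}) (i : 'I_M.+1) : R :=
  fine (P [set om | edge_level om a = i]).

Let N_gt0' : 0 < N%:R :> R. Proof. by rewrite ltr0n. Qed.

Lemma val_level r : level r = minn M (Num.truncn (N%:R * r)) :> nat.
Proof. by rewrite /level inordK // ltnS geq_minl. Qed.

Lemma le_level r : r <= level_value (level r) + N%:R^-1 \/ level r = ord_max.
Proof.
have [trM|Mtr] := ltnP (Num.truncn (N%:R * r)) M; last first.
  by right; apply: ord_inj; rewrite val_level; apply/minn_idPl.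
left; rewrite /level_value val_level (minn_idPr (ltnW trM)).
rewrite -[in X in _ + X](mul1r N%:R^-1) -mulrDl ler_pdivlMr // mulrC.
by rewrite natr1 ltW // truncnS_gt.
Qed.

Lemma level_value_le r : 0 <= r -> level_value (level r) <= r.
Proof.
move=> r0; rewrite /level_value val_level ler_pdivrMr // [leRHS]mulrC.
apply: (@le_trans _ _ (Num.truncn (N%:R * r))%:R).
  by rewrite ler_nat geq_minr.
by rewrite truncn_le mulr_ge0.
Qed.

Lemma level_value_ge0 i : 0 <= level_value i.
Proof. by rewrite divr_ge0. Qed.

Lemma level_value_le_max i : level_value i <= M%:R.
Proof.
rewrite ler_pdivrMr //; apply: (@le_trans _ _ M%:R).
  by rewrite ler_nat -ltnS.
by rewrite ler_peMr // ler1n.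
Qed.

Lemma level_value0_neg r : r < 0 -> level_value (level r) = 0.
Proof.
move=> r0; rewrite /level_value val_level.
have /truncn0Pn -> : ~~ (1 <= N%:R * r).
  by rewrite -ltNge; apply: (@lt_le_trans _ _ 0) => //; rewrite pmulr_rlt0.
by rewrite minn0 mul0r.
Qed.

Lemma measurable_level_ge j : measurable [set r : R | (j <= level r)%N].
Proof.
have [->|j0] := posnP j.
  by rewrite (_ : [set _ | _] = setT) //; apply/seteqP; split.
have [Mj|jM] := ltnP M j.
  rewrite (_ : [set _ | _] = set0) //; apply/seteqP; split => r //=.
  by rewrite val_level; move: (geq_minl M (Num.truncn (N%:R * r))); lia.
rewrite (_ : [set _ | _] = [set` `[j%:R / N%:R, +oo[%R]); first exact: measurable_itv.
apply/seteqP; split => r /=; rewrite val_level leq_min jM /= in_itv /= andbT;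
  rewrite ler_pdivrMr // mulrC.
  by case: j j0 {jM} => // j _; rewrite truncn_gt_nat.
by case: j j0 {jM} => // j _; rewrite truncn_gt_nat.
Qed.

Lemma measurable_level i : measurable [set r : R | level r = i].
Proof.
rewrite (_ : [set _ | _] = [set r | (i <= level r)%N] `\` [set r | (i.+1 <= level r)%N]).
  by apply: measurableD; apply: measurable_level_ge.
apply/seteqP; split => r /=; first by move=> ->; split; rewrite ?ltnn.
by move=> [il /negP]; rewrite -leqNgt => li; apply: ord_inj; lia.
Qed.

Lemma measurable_edge_level a i : measurable [set om | edge_level om a = i].
Proof.
have [aE|aE] := boolP (a \in edges adj).
  rewrite (_ : [set _ | _] = tau a @^-1` [set r | level r = i]).
    by apply: measurable_funPTI; apply: measurable_level.
  by apply/seteqP; split => om /=; rewrite /edge_level aE.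
have [->|ni] := eqVneq i ord0.
  rewrite (_ : [set _ | _] = setT) //; apply/seteqP; split => om //= _.
  by rewrite /edge_level (negbTE aE).
rewrite (_ : [set _ | _] = set0) //; apply/seteqP; split => om //=.
by rewrite /edge_level (negbTE aE) => /esym/eqP; rewrite (negbTE ni).
Qed.

Lemma level_law_ge0 a i : 0 <= level_law a i.
Proof. exact: fine_ge0. Qed.

Lemma level_law_sum a : \sum_i level_law a i = 1.
Proof.
apply: EFin_inj; rewrite -(prob_finite_event _ (measurable_edge_level a) xpredT).
rewrite (_ : [set _ | _] = setT) ?probability_setT //.
by apply/seteqP; split.
Qed.

Lemma exponential_tail a (t : R) : a \in edges adj -> 0 <= t ->
  (P (tau a @^-1` [set r : R | (t < r)%R]) <= (expR (- t))%:E)%E.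
Proof.
move=> aE t0; have mt : measurable [set r : R | t < r].
  rewrite (_ : [set _ | _] = [set` `]t, +oo[%R]); first exact: measurable_itv.
  by apply/seteqP; split => r /=; rewrite in_itv /= andbT.
have mpt : measurable (tau a @^-1` [set r | t < r]) by apply: measurable_funPTI.
have [t00|t1] := eqVneq t 0.
  by apply: le_trans (probability_le1 P mpt) _; rewrite t00 oppr0 expR0.
have tp : 0 < t by rewrite lt_neqAle eq_sym t1.
have mi : measurable (tau a @^-1` [set` `[0, t]%R]) by apply: measurable_funPTI; apply: measurable_itv.
have Pi : P (tau a @^-1` [set` `[0, t]%R]) = (1 - expR (- t))%:E.
  have := weights_tau.1 a aE [set` `[0, t]%R] (measurable_itv _).
  rewrite exponential_prob_itv0c //.
  by rewrite /distribution /pushforward mulN1r EFinB.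
apply: (@le_trans _ _ (P (~` (tau a @^-1` [set` `[0, t]%R])))).
  apply: le_measure; rewrite ?inE //; first exact: measurableC.
  by move=> om /= tr; rewrite in_itv /= => /andP[_]; rewrite leNgt tr.
by rewrite probability_setC // Pi -EFinB lee_fin; lra.
Qed.

Lemma level_law_tail a (t : R) : 0 <= t ->
  \sum_(i | t < level_value i) level_law a i <= expR (- t).
Proof.
move=> t0; rewrite -lee_fin -(prob_finite_event _ (measurable_edge_level a) (fun i => t < level_value i)).
have [aE|aE] := boolP (a \in edges adj); last first.
  rewrite (_ : [set _ | _] = set0) ?measure0 ?lee_fin ?expR_ge0 //.
  apply/seteqP; split => om //=.
  by rewrite /edge_level (negbTE aE) /level_value mul0r ltNge t0.
apply: le_trans (exponential_tail aE t0); apply: le_measure; rewrite ?inE.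
- exact: (measurable_finite_event (measurable_edge_level a) (fun i => t < level_value i)).
- apply: measurable_funPTI.
  rewrite (_ : [set _ | _] = [set` `]t, +oo[%R]); first exact: measurable_itv.
  by apply/seteqP; split => r /=; rewrite in_itv /= andbT.
move=> om /=; rewrite /edge_level aE => tl.
have [r0|r0] := leP 0 (tau a om); first exact: lt_le_trans tl (level_value_le r0).
by move: tl; rewrite level_value0_neg // ltNge t0.
Qed.

Lemma levels_fiber (s : {ffun {set V} -> 'I_M.+1}) :
  [set om | levels om = s] = \bigcap_(a in [set: {set V}]) [set om | edge_level om a = s a].
Proof.
apply/seteqP; split => om /=; first by move=> <- a _ /=; rewrite ffunE.
by move=> H; apply/ffunP => a; rewrite ffunE; apply: H.
Qed.

Lemma measurable_levels s : measurable [set om | levels om = s].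
Proof.
rewrite levels_fiber; apply: fin_bigcap_measurable => // a _.
exact: measurable_edge_level.
Qed.

(** Mutual independence is only known for the edges; the other levels are
    constant. *)
Lemma levels_law s : fine (P [set om | levels om = s]) = \prod_a level_law a (s a).
Proof.
have [/forallP H|/forallPn[a]] := boolP [forall a, (a \notin edges adj) ==> (s a == ord0)].
  have -> : [set om | levels om = s] =
      \bigcap_(a in [set` edges adj]) (tau a @^-1` [set r | level r = s a]).
    apply/seteqP; split => om /=.
      by move=> <- a /= aE; rewrite ffunE /edge_level aE.
    move=> K; apply/ffunP => a; rewrite ffunE /edge_level; case: ifP => aE.
      exact: K.
    by have := H a; rewrite aE => /eqP->.
  rewrite (weights_tau.2 (edges adj) (fun a => [set r | level r = s a])) //; last first.
    by move=> a; apply: measurable_level.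
  rewrite (eq_bigr (fun a => (level_law a (s a))%:E)) => [|a aE].
    rewrite prodEFin /= [RHS](bigID (mem (edges adj))) /= [X in _ * X]big1 ?mulr1 //.
    move=> a aE; have := H a; rewrite aE => /eqP ->.
    rewrite /level_law (_ : [set _ | _] = setT) ?probability_setT //.
    by apply/seteqP; split => om //= _; rewrite /edge_level (negbTE aE).
  rewrite /level_law fineK ?fin_num_measure //; last exact: measurable_edge_level.
  by congr (P _); apply/seteqP; split => om /=; rewrite /edge_level aE.
rewrite negb_imply => /andP[aE sa].
have empty (i : 'I_M.+1) : i != ord0 -> [set om | edge_level om a = i] = set0.
  move=> i0; apply/seteqP; split => om //=; rewrite /edge_level (negbTE aE) => /esym/eqP.
  by rewrite (negbTE i0).
rewrite (bigD1 a) //= /level_law empty // measure0 mul0r.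
rewrite (_ : [set _ | _] = set0) ?measure0 //.
apply/seteqP; split => om //= E.
have : [set om | edge_level om a = s a] om by rewrite /= -E ffunE.
by rewrite empty.
Qed.

Lemma prob_levels (A : pred {ffun {set V} -> 'I_M.+1}) :
  P [set om | A (levels om)] = (prob level_law A)%:E.
Proof.
rewrite (prob_finite_event _ measurable_levels A) /prob /expect; congr (_%:E).
rewrite big_mkcond; apply: eq_bigr => s _; rewrite levels_law.
by case: (A s); rewrite ?mulr1 ?mulr0.
Qed.

End Discretization.

(** * The covering time of the grid *)

Section MeasurableCover.
Variables (R : realType) (dT : measure_display) (T : measurableType dT).

Let measurable_bigmin (I : Type) (l : seq I) (A : pred I) (F : I -> T -> \bar R) :
  (forall i, measurable_fun setT (F i)) ->
  measurable_fun setT (fun om => \big[Order.min/+oo%E]_(i <- l | A i) F i om).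
Proof.
move=> mF; elim: l => [|i l IH]; first by under eq_fun do rewrite big_nil; exact: measurable_cst.
under eq_fun do rewrite big_cons.
by case: (A i) => //; apply: measurable_mine.
Qed.

Let measurable_bigmax (I : Type) (l : seq I) (A : pred I) (F : I -> T -> \bar R) :
  (forall i, measurable_fun setT (F i)) ->
  measurable_fun setT (fun om => \big[Order.max/-oo%E]_(i <- l | A i) F i om).
Proof.
move=> mF; elim: l => [|i l IH]; first by under eq_fun do rewrite big_nil; exact: measurable_cst.
under eq_fun do rewrite big_cons.
by case: (A i) => //; apply: measurable_maxe.
Qed.

Lemma measurable_fpp_cover_time (P : probability T R) (V : finType) (adj : rel V)
    (tau : {set V} -> {RV P >-> R}) x :
  measurable_fun setT (fun om => fpp_cover_time adj (fun a => tau a om) x).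
Proof.
apply: measurable_bigmax => y; apply: measurable_bigmin => p.
by apply/measurable_EFinP; apply: measurable_sum => a.
Qed.

End MeasurableCover.

Section GridCover.
Variables (R : realType) (d k : nat).
Hypotheses (d_gt0 : (0 < d)%N) (k_gt0 : (0 < k)%N).
Local Notation V := (grid_vertex d k).
Local Notation adj := (@grid_adj R d k).
Variables (dT : measure_display) (T : measurableType dT) (P : probability T R).
Variable tau : {set V} -> {RV P >-> R}.
Hypothesis weights_tau : fpp_weights adj tau.
Variable c : nat.
Hypotheses (c_gt0 : (0 < c)%N) (cE : 384 / c%:R = 3^-1 * 8^-1 ^+ 3 :> R).

Let n := ((k + 1) ^ d)%N.

Let cardV : #|V| = n.
Proof. by rewrite card_ffun !card_ord /n addn1. Qed.

Let n_gt0 : (0 < n)%N.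
Proof. by rewrite expn_gt0 addn1. Qed.

Let card_edge_gt0 : (0 < #|{set V}|)%N.
Proof. by apply/card_gt0P; exists finset.set0. Qed.

Let square_card : (n * n <= 8 ^ (k * d))%N.
Proof.
have kn : (k + 1 <= 2 ^ k)%N by rewrite addn1 ltn_expl.
have n2 : (n <= 2 ^ (k * d))%N by rewrite expnM /n leq_exp2r.
apply: leq_trans (leq_mul n2 n2) _.
by rewrite -expnMn leq_exp2r // muln_gt0 k_gt0.
Qed.

(** Two kinds of failure: some weight is truncated, with total probability at
    most [1 / n], or some vertex is far in the rounded model, with total
    probability at most [n * 2 * 8^-1 ^+ (k * d)], which is at most [2 / n]
    because [n <= 2 ^ (k * d)]. *)
Lemma grid_cover_time_prob x :
  ((1 - 3 / n%:R)%:E <= P [set om | (fpp_cover_time adj (fun a => tau a om) x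
     <= ((6 * c%:R + 1) * k%:R)%:E)%E])%E.
Proof.
have n0 : 0 < n%:R :> R by rewrite ltr0n.
(* The truncation level is [m.+1 / n], just above [#|{set V}| * n]; by the tail
   bound each weight is truncated with probability at most the inverse of that
   number. *)
pose m := (n * (#|{set V}| * n))%N.
pose law := level_law adj tau n (M := m.+1).
have law0 : forall a i, 0 <= law a i by move=> a i; apply: level_law_ge0.
have law1 : forall a, \sum_i law a i = 1 by move=> a; apply: level_law_sum.
pose value := @level_value R n m.+1.
pose far v (s : {ffun {set V} -> 'I_m.+2}) : bool :=
  ~~ `[< reach adj (fun a => value (s a)) x v (6 * (c * k)%:R) >].
pose over a (s : {ffun {set V} -> 'I_m.+2}) : bool := s a == ord_max.
pose bad s := [exists a, over a s] || [exists v, far v s].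
have Pover : prob law (fun s => [exists a, over a s]) <= n%:R^-1.
  apply: le_trans (prob_exists law0 over) _.
  apply: (@le_trans _ _ (\sum_(a : {set V}) (#|{set V}| * n)%:R^-1)).
    apply: ler_sum => a _.
    have -> : prob law (over a) = law a ord_max.
      rewrite /prob (expect_coord law1 a (fun i => (i == ord_max)%:R)).
      rewrite (bigD1 ord_max) //= eqxx mulr1 big1 ?addr0 // => i /negbTE->.
      by rewrite mulr0.
    set t : R := (#|{set V}| * n)%:R.
    have t0 : 0 < t by rewrite ltr0n muln_gt0 card_edge_gt0.
    apply: (@le_trans _ _ (expR (- t))); last first.
      rewrite expRN lef_pV2 ?posrE ?expR_gt0 //.
      by apply: le_trans (expR_ge1Dx t); rewrite lerDr.
    apply: le_trans (level_law_tail weights_tau m.+1 n_gt0 a (ltW t0)).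
    rewrite (bigD1 ord_max) /=; first by rewrite lerDl sumr_ge0.
    by rewrite /level_value ltr_pdivlMr // -natrM ltr_nat /= ltnS /m mulnC.
  rewrite sumr_const -[_ *+ _]mulr_natl natrM invfM mulrA mulfV ?mul1r //.
  by rewrite pnatr_eq0 -lt0n.
have Pfar : prob law (fun s => [exists v, far v s]) <= 2 / n%:R.
  apply: le_trans (prob_exists law0 far) _.
  apply: (@le_trans _ _ (\sum_(v : V) 2 * 8^-1 ^+ (k * d))).
    apply: ler_sum => v _.
    apply: (prob_no_reach law0 law1 _ _ _ x v d_gt0 k_gt0 c_gt0 cE).
    - by move=> i; apply: level_value_ge0.
    - by move=> i; apply: level_value_le_max.
    - by move=> a t; apply: level_law_tail.
  rewrite sumr_const -[_ *+ _]mulr_natl cardV mulrCA ler_wpM2l //.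
  rewrite exprVn ler_pdivrMr ?exprn_gt0 // mulrC ler_pdivlMr //.
  by rewrite -natrM -natrX ler_nat square_card.
have Pbad : prob law bad <= 3 / n%:R.
  by apply: le_trans (probU law0 _ _) _; lra.
pose lev := levels adj tau n m.+1.
have mlev s : measurable [set om | lev om = s].
  exact: measurable_levels.
have mbad : measurable [set om | bad (lev om)].
  exact: (measurable_finite_event mlev bad).
apply: (@le_trans _ _ (P (~` [set om | bad (lev om)]))).
  rewrite probability_setC // (prob_levels weights_tau n_gt0 bad) -EFinB lee_fin.
  by rewrite lerD2l lerN2.
apply: le_measure; rewrite ?inE.
- exact: measurableC.
- rewrite (_ : [set _ | _] = (fun om => fpp_cover_time adj (fun a => tau a om) x) @^-1`
    [set` `]-oo, ((6 * c%:R + 1) * k%:R)%:E]%O]).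
    rewrite -[X in measurable X]setTI; apply: measurable_fpp_cover_time => //.
    exact: emeasurable_itv.
  by apply/seteqP; split => om /=; rewrite in_itv.
move=> om /= /negP; rewrite negb_or => /andP[/existsPn noover /existsPn nofar].
apply: fpp_cover_time_le => y.
have /negPn/asboolP ry := nofar y.
have n_inv : 0 <= n%:R^-1 :> R by rewrite invr_ge0.
apply: le_trans (fpp_time_le _ n_inv _ ry) _.
- by move=> a; apply: level_value_ge0.
- move=> a aE; have := noover a; rewrite /over /lev ffunE /edge_level aE.
  by case: (le_level m.+1 n_gt0 (tau a om)) => [//|->]; rewrite eqxx.
have k1 : 1 <= k%:R :> R by rewrite ler1n.
by rewrite lee_fin cardV mulfV ?gt_eqF // natrM; lra.
Qed.

End GridCover.

Theorem theorem6 (R : realType) :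
  exists (C : R) (f : nat -> R),
    [/\ 0 < C,
        f @ \oo --> (0 : R) &
        forall d k : nat, (1 <= d)%N -> (1 <= k)%N ->
        forall (dT : measure_display) (T : measurableType dT)
          (P : probability T R)
          (tau : {set grid_vertex d k} -> {RV P >-> R}),
          fpp_weights (@grid_adj R d k) tau ->
        forall s : grid_vertex d k,
          (P [set om | (fpp_cover_time (@grid_adj R d k)
                          (fun a => tau a om) s <= (C * k%:R)%:E)%E]
             >= (1 - f ((k + 1) ^ d)%N)%:E)%E].
Proof.
(* With this [c] the ratio [384 / c] is [8 ^- 3 / 3], as [prob_no_reach]
   requires; the final constant has an extra 1 to pay for the rounding. *)
pose c := (384 * (3 * 8 ^ 3))%N.
have c0 : (0 < c)%N by rewrite /c !muln_gt0.
have cE : 384 / c%:R = 3^-1 * 8^-1 ^+ 3 :> R.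
  rewrite /c natrM natrM natrX invfM mulrA mulfV ?mul1r; last by rewrite pnatr_eq0.
  by rewrite invfM exprVn.
(* [harmonic n] is the inverse of [n.+1], whence 6 instead of 3. *)
exists (6 * c%:R + 1), (fun n => 6 * harmonic n); split.
- by rewrite addr_gt0 // mulr_gt0 // ltr0n.
- rewrite -[X in _ --> X](mulr0 6); apply: cvgM; first exact: cvg_cst.
  exact: cvg_harmonic.
move=> d k d0 k0 dT T P tau weights_tau s.
apply: le_trans (grid_cover_time_prob d0 k0 weights_tau c0 cE s).
rewrite lee_fin lerD2l lerN2 /harmonic.
set n := ((k + 1) ^ d)%N.
have n0 : (0 < n)%N by rewrite expn_gt0 addn1.
have n1 : 1 <= n%:R :> R by rewrite ler1n.
rewrite ler_pdivrMr ?ltr0n // mulrAC ler_pdivlMr // -natr1; lra.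
Qed.
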